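(* Let $d\ge2$, let $F_d$ be the free group on free generators $a_1,\dots,a_d$, and let $\lambda$ be a symmetric probability measure supported on $\{a_1^{\pm1},\dots,a_d^{\pm1}\}$ whose support generates $F_d$. Then there is a symmetric generating probability measure $\mu$ (not necessarily equal to $\lambda$) supported on $\{a_1^{\pm1},\dots,a_d^{\pm1}\}$ such that $$I_\lambda(F_d)=h_\lambda(\partial F_d,\nu_\mu),$$ where $\nu_\mu$ is the harmonic (hitting, stationary) measure of the $\mu$-random walk on the boundary $\partial F_d$.
   Context: A measure on $F_d$ is symmetric if it is invariant under $g\mapsto g^{-1}$, and generating if its support generates $F_d$. $\partial F_d$ is the compact space of infinite reduced words in $a_1^{\pm1},\dots,a_d^{\pm1}$ with its natural continuous $F_d$-action. For a symmetric generating probability measure $\mu$ on $F_d$ supported on $\{a_1^{\pm1},\dots,a_d^{\pm1}\}$, the $\mu$-random walk $R_n=s_1\cdots s_n$ ($s_i$ i.i.d. with law $\mu$) converges a.s. to a point of $\partial F_d$; $\nu_\mu$ is the law of the limit, which is the unique Borel probability measure on $\partial F_d$ with $\mu\ast\nu_\mu=\sum_g\mu(g)\,g\nu_\mu=\nu_\mu$. For probability measures $m,\nu$ in the same measure class on a measurable space $X$, $D_{KL}(m\|\nu):=\int_X -\ln\left(\frac{d\nu}{dm}\right)dm\in[0,\infty]$. For a group $G$ acting measurably on $X$, a quasi-invariant probability measure $\nu$ on $X$ and a probability measure $\lambda$ on $G$, $h_\lambda(X,\nu):=\sum_{g\in G}\lambda(g)D_{KL}(g\nu\|\nu)$, with $g\nu$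 the push-forward of $\nu$ by $g$. $I_\lambda(G):=\inf_\eta h_\lambda(G,\eta)$, the infimum over all fully supported probability measures $\eta$ on $G$, where $G$ acts on itself by left translation. *)

(* Defs.v *)
From HB Require Import structures.
From mathcomp Require Import all_boot all_order all_algebra.
From mathcomp Require Import all_classical all_reals all_analysis.

Set Implicit Arguments.
Unset Strict Implicit.
Unset Printing Implicit Defensive.

Import Order.TTheory GRing.Theory Num.Theory.

Local Open Scope classical_set_scope.
Local Open Scope ring_scope.

(* The letter (i, false) stands for a_i and (i, true) for a_i^-1. *)
Definition letter (d : nat) : Type := ('I_d * bool)%type.
HB.instance Definition _ d := Finite.on (letter d).

Definition inv_letter d (x : letter d) : letter d := (x.1, ~~ x.2).

Lemma inv_letterK d : involutive (@inv_letter d).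
Proof. by case=> i b; rewrite /inv_letter /= negbK. Qed.

Definition reduced d : pred (seq (letter d)) :=
  sorted (fun x y => y != inv_letter x).

(* The free group F_d, realised by the reduced words. *)
Record free_group (d : nat) :=
  FreeGroup { word : seq (letter d); word_reduced : reduced word }.

HB.instance Definition _ d := [isSub for @word d].
HB.instance Definition _ d := [Countable of free_group d by <:].

Section FreeGroupLaw.
Variable d : nat.
Implicit Types (x y : letter d) (w : seq (letter d)) (g h : free_group d).

(* The reduced form of the word x :: w, for a reduced word w. *)
Definition push x w : seq (letter d) :=
  if w is y :: w' then if y == inv_letter x then w' else x :: w else [:: x].

Lemma push_reduced x w : reduced w -> reduced (push x w).
Proof.
case: w => [|y w] //= rw; case: ifPn => yx; last by rewrite /reduced /= yx.
by move: rw; rewrite /reduced /=; case: w => //= z w /andP[].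
Qed.

Lemma foldr_push_reduced u w : reduced w -> reduced (foldr push w u).
Proof. by move=> rw; elim: u => //= x u; apply: push_reduced. Qed.

Definition fg_one : free_group d := @FreeGroup d [::] isT.

Definition fg_mul g h : free_group d :=
  FreeGroup (foldr_push_reduced (word g) (word_reduced h)).

Lemma inv_word_reduced w : reduced w -> reduced (rev (map (@inv_letter d) w)).
Proof.
rewrite /reduced rev_sorted sorted_map; apply: sub_sorted => x y /=.
by rewrite inv_letterK; apply: contra => /eqP <-.
Qed.

Definition fg_inv g : free_group d := FreeGroup (inv_word_reduced (word_reduced g)).

Lemma pushK x w : reduced w -> push x (push (inv_letter x) w) = w.
Proof.
case: w => [|y w] /=; first by rewrite eqxx.
rewrite inv_letterK; have [-> | yx] := eqVneq y x; last by rewrite /= eqxx.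
by case: w => //= z w; rewrite /reduced /= => /andP[/negbTE ->].
Qed.

Lemma foldr_push_push x u w : reduced u -> reduced w ->
  foldr push w (push x u) = push x (foldr push w u).
Proof.
case: u => [|y u] //= ru rw; case: ifPn => // /eqP ->.
by rewrite pushK // foldr_push_reduced.
Qed.

Lemma foldr_push_cat u v w : reduced v -> reduced w ->
  foldr push w (foldr push v u) = foldr push (foldr push w v) u.
Proof.
move=> rv rw; elim: u => //= x u IH.
by rewrite foldr_push_push ?IH // foldr_push_reduced.
Qed.

Lemma foldr_push_nil w : reduced w -> foldr push [::] w = w.
Proof.
elim: w => //= x w IH rw; rewrite IH; last first.
  by move: rw; rewrite /reduced /=; exact: path_sorted.
by move: rw; rewrite /reduced /=; case: w {IH} => //= y w /andP[/negbTE ->].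
Qed.

Lemma fg_mulA : associative fg_mul.
Proof.
by move=> g h k; apply: val_inj; rewrite /= foldr_push_cat //; exact: word_reduced.
Qed.

Lemma fg_mul1 : left_id fg_one fg_mul.
Proof. by move=> g; apply: val_inj. Qed.

Lemma fg_mulr1 : right_id fg_one fg_mul.
Proof. by move=> g; apply: val_inj; rewrite /= foldr_push_nil // word_reduced. Qed.

Lemma foldr_push_inv u w : reduced w ->
  foldr push (foldr push w (rev (map (@inv_letter d) u))) u = w.
Proof.
move=> rw; elim: u w rw => //= x u IH w rw.
rewrite rev_cons foldr_rcons IH ?push_reduced //; exact: pushK.
Qed.

Lemma fg_mulV : right_inverse fg_one fg_inv fg_mul.
Proof.
move=> g; apply: val_inj => /=.
by have := foldr_push_inv (word g) (isT : reduced [::]);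
   rewrite (foldr_push_nil (word_reduced (fg_inv g))).
Qed.

Lemma fg_invK : involutive fg_inv.
Proof.
move=> g; apply: val_inj; rewrite /= map_rev revK -map_comp.
by rewrite (eq_map (@inv_letterK d)) map_id.
Qed.

Lemma fg_mulVg : left_inverse fg_one fg_inv fg_mul.
Proof. by move=> g; rewrite -{2}[g]fg_invK fg_mulV. Qed.

HB.instance Definition _ :=
  isGroup.Build (free_group d) fg_mulA fg_mul1 fg_mulr1 fg_mulVg fg_mulV.

Definition generator (i : 'I_d) : free_group d := @FreeGroup d [:: (i, false)] isT.

End FreeGroupLaw.

HB.instance Definition _ d := isPointed.Build (free_group d) (1%g : free_group d).
HB.instance Definition _ d := @isMeasurable.Build default_measure_display
  (free_group d) discrete_measurable discrete_measurable0
  discrete_measurableC discrete_measurableU.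

Definition reduced_seq (d : nat) :
    set (prod_topology (fun _ : nat => discrete_topology (letter d))) :=
  [set xi | forall n, xi n.+1 != inv_letter (xi n)].

Arguments reduced_seq : clear implicits.

(* The infinite reduced words, with the topology induced by the product of the
   discrete topologies. *)
Definition boundary (d : nat) : Type := set_type (reduced_seq d).
HB.instance Definition _ d := Topological.copy (boundary d) (set_type (reduced_seq d)).

Section BoundaryAction.
Variable d : nat.
Implicit Types (x : letter d) (xi : boundary d) (g h : free_group d).

Definition bletter xi (n : nat) : letter d := val xi n.

Lemma bletterP xi n : bletter xi n.+1 != inv_letter (bletter xi n).
Proof. by have /set_mem := valP xi; apply. Qed.

Lemma boundary_inj xi eta : bletter xi =1 bletter eta -> xi = eta.
Proof. by move=> E; apply: val_inj; apply/funext. Qed.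

(* The reduced form of the infinite word x xi. *)
Definition bpush_seq x xi : nat -> letter d := fun n =>
  if bletter xi 0 == inv_letter x then bletter xi n.+1
  else if n is m.+1 then bletter xi m else x.

Lemma bpush_seqP x xi : bpush_seq x xi \in reduced_seq d.
Proof.
apply/mem_set => n; rewrite /bpush_seq; case: ifPn => ?; first exact: bletterP.
by case: n => //= n; exact: bletterP.
Qed.

Definition bpush x xi : boundary d := SigSub (bpush_seqP x xi).

Definition boundary_act g xi : boundary d := foldr bpush xi (word g).

Lemma bpushK x xi : bpush x (bpush (inv_letter x) xi) = xi.
Proof.
apply: boundary_inj => n; rewrite /bletter /= /bpush_seq /bletter /= /bpush_seq.
rewrite inv_letterK; have [E|E] := eqVneq (bletter xi 0) x.
  have := bletterP xi 0; rewrite E => /negbTE -> /=.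
  by case: n.
by rewrite eqxx.
Qed.

Lemma foldr_bpush_push x w xi :
  foldr bpush xi (push x w) = bpush x (foldr bpush xi w).
Proof. by case: w => [|y w] //=; case: ifPn => // /eqP ->; rewrite bpushK. Qed.

Lemma boundary_act1 xi : boundary_act 1%g xi = xi.
Proof. by []. Qed.

Lemma boundary_actM g h xi :
  boundary_act (g * h)%g xi = boundary_act g (boundary_act h xi).
Proof.
rewrite /boundary_act /= /fg_mul /=; elim: (word g) => //= x u IH.
by rewrite foldr_bpush_push IH.
Qed.

Lemma near_bletter xi n : \forall eta \near xi, bletter eta n = bletter xi n.
Proof.
have c1 := @initial_continuous (reduced_seq d) _ set_val xi.
have c2 := @proj_continuous _ (fun _ : nat => discrete_topology (letter d)) n (val xi).
have c3 := @cvg_comp _ _ _ _ _ _ _ _ c1 c2.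
have := c3 _ (@discrete_set1 (discrete_topology (letter d)) (val xi n)).
by rewrite nbhs_simpl.
Qed.

Lemma near_bpush_seq x xi n :
  \forall eta \near xi, bpush_seq x eta n = bpush_seq x xi n.
Proof.
near=> eta.
have E0 : bletter eta 0 = bletter xi 0 by near: eta; exact: near_bletter.
have E1 : bletter eta n.+1 = bletter xi n.+1 by near: eta; exact: near_bletter.
have E2 : bletter eta n.-1 = bletter xi n.-1 by near: eta; exact: near_bletter.
by rewrite /bpush_seq E0 E1; case: (n) E2 => //= m ->.
Unshelve. all: by end_near. Qed.

Lemma bpush_continuous x : continuous (bpush x).
Proof.
move=> xi A [_ [[B oB <-] /= Bxi BA]].
have FX := @nbhs_filter (boundary d) xi.
pose S := prod_topology (fun _ : nat => discrete_topology (letter d)).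
have H : (bpush_seq x : boundary d -> S) @ xi --> (bpush_seq x xi : S).
  have FF : Filter ((bpush_seq x : boundary d -> S) @ xi) by exact: fmap_filter.
  apply/cvg_sup => n U [_ [[V oV <-] /= Vx VU]].
  apply: filterS (near_bpush_seq x xi n) => eta E; apply: VU => /=.
  by rewrite E.
have HB : nbhs (bpush_seq x xi : S) B by apply: open_nbhs_nbhs; split.
suff : nbhs xi (bpush x @^-1` (set_val @^-1` B)).
  by apply: filterS => eta; exact: BA.
exact: (H B HB).
Qed.

Lemma boundary_act_continuous g : continuous (boundary_act g).
Proof.
rewrite /boundary_act; elim: (word g) => [|x u IH] xi /=; first exact: cvg_id.
apply: (@continuous_comp _ _ _ (fun eta => foldr bpush eta u) (bpush x)).
  exact: IH.
exact: bpush_continuous.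
Qed.

End BoundaryAction.

(* Measurable types are pointed, and the boundary is empty in rank 0, so the
   Borel structure is put on the boundaries of positive rank. *)
Section BoundaryPoint.
Variable d : nat.

Lemma boundary_point_subproof :
  (fun _ : nat => (ord0, false) : letter d.+1) \in reduced_seq d.+1.
Proof. by apply/mem_set => n. Qed.

HB.instance Definition _ := isPointed.Build (boundary d.+1)
  (SigSub boundary_point_subproof : boundary d.+1).

HB.instance Definition _ := @isMeasurable.Build
  (sigma_display (@open (boundary d.+1))) (boundary d.+1)
  <<s (@open (boundary d.+1)) >>
  (@sigma_algebra0 _ setT _) (@sigma_algebraC _ _) (@sigma_algebra_bigcup _ setT _).

End BoundaryPoint.

Section MeasurableActions.
Variable d : nat.

Definition left_translation (g : free_group d) : free_group d -> free_group d :=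
  fun h => (g * h)%g.

Lemma left_translation_measurable g : measurable_fun setT (left_translation g).
Proof. by []. Qed.

HB.instance Definition _ g := isMeasurableFun.Build _ _ _ _
  (left_translation g) (left_translation_measurable g).

Lemma boundary_act_measurable (g : free_group d.+1) :
  measurable_fun setT (@boundary_act d.+1 g).
Proof.
apply: (@measurability _ _ _ _ _ _ (@open (boundary d.+1))) => //.
move=> _ [A oA <-]; rewrite setTI; apply: sub_sigma_algebra.
by have /continuousP := @boundary_act_continuous d.+1 g; apply.
Qed.

HB.instance Definition _ g := isMeasurableFun.Build _ _ _ _
  (@boundary_act d.+1 g) (boundary_act_measurable g).

End MeasurableActions.

Section Entropy.
Local Open Scope ereal_scope.
Local Open Scope charge_scope.
Variable R : realType.

(* D_KL(m || nu), meant for m and nu in the same measure class: the derivative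
   is then m-almost everywhere positive and finite. *)
Definition KL_divergence dX (X : measurableType dX) (m nu : probability X R) :
    \bar R :=
  \int[m]_x - lne (('d (charge_of_finite_measure nu) '/d m) x).

(* h_lambda(X, nu) for the action act of G on X. *)
Definition entropy dG (G : measurableType dG) dX (X : measurableType dX)
    (act : G -> {mfun X >-> X}) (lambda : probability G R)
    (nu : probability X R) : \bar R :=
  \esum_(g in [set: G]) (lambda [set g] * KL_divergence (distribution nu (act g)) nu).

Definition group_entropy d (lambda eta : probability (free_group d) R) : \bar R :=
  entropy (fun g : free_group d => left_translation g) lambda eta.

Definition boundary_entropy d (lambda : probability (free_group d.+1) R)
    (nu : probability (boundary d.+1) R) : \bar R :=
  entropy (fun g : free_group d.+1 => boundary_act g) lambda nu.

(* I_lambda(F_d) *)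
Definition inf_entropy d (lambda : probability (free_group d) R) : \bar R :=
  ereal_inf [set group_entropy lambda eta | eta in
    [set eta : probability (free_group d) R | forall g, 0 < eta [set g]]].

End Entropy.

Section RandomWalk.
Local Open Scope ereal_scope.
Variable R : realType.

Definition msupport d (mu : probability (free_group d) R) : set (free_group d) :=
  [set g | 0 < mu [set g]].

Definition symmetric_measure d (mu : probability (free_group d) R) : Prop :=
  forall A : set (free_group d), mu ((fun g => g^-1%g) @^-1` A) = mu A.

Definition generating_measure d (mu : probability (free_group d) R) : Prop :=
  forall H : {pred free_group d}, group_closed H ->
    (forall g, msupport mu g -> g \in H) -> forall g, g \in H.

Definition supported_on_generators d (mu : probability (free_group d) R) : Prop :=
  forall g, msupport mu g ->
    exists i : 'I_d, g = generator i \/ g = (generator i)^-1%g.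

Definition independent_RVs dO (O : measurableType dO) (P : probability O R)
    dS (S : measurableType dS) (s : nat -> {RV P >-> S}) : Prop :=
  forall (I : seq nat) (A : nat -> set S), uniq I -> (forall i, measurable (A i)) ->
    P (\bigcap_(i in [set` I]) s i @^-1` A i) = \prod_(i <- I) P (s i @^-1` A i).

Definition walk d (s : nat -> free_group d) (n : nat) : free_group d :=
  (\prod_(i < n) s i)%g.

(* Convergence of the words g_n to the infinite word xi in the compact space
   formed by F_d and its boundary: every finite prefix of xi is eventually a
   prefix of g_n. *)
Definition cvg_to_boundary d (g : nat -> free_group d) (xi : boundary d) : Prop :=
  forall k, \forall n \near \oo, take k (word (g n)) = mkseq (bletter xi) k.

(* nu is the law of the almost sure limit X in the boundary of the random walk
   R_n = s_0 ... s_(n-1), with s_i i.i.d. of law mu. *)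
Definition hitting_measure d (mu : probability (free_group d.+1) R)
    (nu : probability (boundary d.+1) R) : Prop :=
  exists (dO : measure_display) (O : measurableType dO) (P : probability O R)
    (s : nat -> {RV P >-> free_group d.+1}) (X : {RV P >-> boundary d.+1}),
    [/\ independent_RVs s,
        forall i A, measurable A -> distribution P (s i) A = mu A,
        {ae P, forall w, cvg_to_boundary (walk (fun i => s i w)) (X w)}
      & forall A, measurable A -> distribution P X A = nu A].

End RandomWalk.

(* Main.v *)
From HB Require Import structures.
Require Import Defs.
From mathcomp Require Import all_boot all_order all_algebra.
From mathcomp Require Import all_classical all_reals all_analysis.
From mathcomp Require Import measurable_realfun.
From mathcomp Require Import zify ring lra.

(* Let A_x be the set of words (finite or infinite) starting with the letter x.
   For the nearest neighbour walk mu with passage probabilities F_x = exp(-s_x),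
   the hitting measure nu satisfies nu(x B) = F_x nu(B) for B disjoint from
   A_(x^-1), so d(nu)/d(x nu) is exp(-s_x) on A_x and exp(s_x) elsewhere,
   nu(A_x) = 1 / (1 + exp s_x) and
     h_lambda(nu) = sum_x lambda_x (1 - 2 nu(A_x)) s_x.
   The tangent inequality for - ln, with these two values of the density, bounds
   h_lambda(eta) from below, for every fully supported eta on F_d, by an affine
   function of the masses eta(A_x), whose sum is at most 1.  If s is a critical
   point of the functional above under the constraint sum_x nu(A_x) = 1, all the
   coefficients are equal, and the bound is h_lambda(nu).  Conversely the
   probability measures on F_d proportional to w |-> prod_i exp(-s_(w_i) - e)
   have the same multiplicativity with s + e in place of s, and their entropies
   tend to h_lambda(nu) as e tends to 0.  The critical s exists by the
   intermediate value theorem, and determines mu. *)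

Set Implicit Arguments.
Unset Strict Implicit.
Unset Printing Implicit Defensive.

Import Order.TTheory GRing.Theory Num.Theory.
Import numFieldNormedType.Exports.

Local Open Scope classical_set_scope.
Local Open Scope ring_scope.

(** * Kullback-Leibler divergence and entropy of an action *)

(** The step law [mu] is reached backwards: the passage probabilities F are prescribed, and the
    difficulty is to show that some walk realizes them. Its step weights are forced, and with them
    the function w |-> prod_i F(w_i) is harmonic off the identity; this gives transience while the
    true passage probabilities q are still unknown. Two relations then link q to the masses v of the
    limit law on the boundary cones: the Markov property at the first passage through a letter, and
    stationarity under the first step. Together with total mass 1 they leave q = F as the only
    possibility. On the group side the parameter s itself is out of reach: the constraint that the
    cones have total mass 1 would leave no mass for the empty word, and the weights are not
    summable. Hence the approximation by s + e. *)

Section LnE.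
Context {R : realType}.

Lemma measurable_lne_comp d (T : measurableType d) (D : set T) (f : T -> \bar R) :
  measurable_fun D f -> (forall x, f x \is a fin_num) ->
  measurable_fun D (fun x => lne (f x)).
Proof.
move=> mf ff.
pose h x : \bar R := if fine (f x) <= 0 then -oo%E else (ln (fine (f x)))%:E.
have hE : (fun x => lne (f x)) = h.
  by apply/funext => x; rewrite /h -{1}(fineK (ff x)).
rewrite hE => mD.
have mff : measurable_fun D (fine \o f) by exact: measurableT_comp.
apply: measurable_fun_if => //.
- apply: measurable_fun_ler => //.
- apply: measurableT_comp => //; apply: measurableT_comp => //.
  exact: measurable_funS mff.
Qed.

(** The left side is the tangent of - ln at the point exp(-s); the inequality is ln(1 + u) <= u for
    u = exp(s) x - 1. For x <= 0 the right side is +oo. *)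
Lemma lne_tangent (s : R) (x : \bar R) : x \is a fin_num ->
  ((s + 1)%:E - (expR s)%:E * x <= - lne x)%E.
Proof.
case: x => // r _ /=; case: ifPn => [_|]; first by rewrite leey.
rewrite -ltNge => r0.
rewrite -EFinD -EFinN lee_fin.
have e0 := expR_gt0 s.
have /le_ln1Dx : -1 < expR s * r - 1 by rewrite ltrBrDr addNr mulr_gt0.
rewrite addrC subrK lnM ?posrE // expRK; lra.
Qed.

End LnE.

Section Prob.
Context d {T : measurableType d} {R : realType}.
Implicit Types P : probability T R.

Definition pr P (A : set T) : R := fine (P A).

Lemma prE P A : measurable A -> P A = (pr P A)%:E.
Proof. by move=> mA; rewrite /pr fineK // fin_num_measure. Qed.

Lemma pr_ge0 P A : 0 <= pr P A.
Proof. exact: fine_ge0. Qed.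

Lemma pr_le1 P A : measurable A -> pr P A <= 1.
Proof. by move=> mA; rewrite -lee_fin -prE // probability_le1. Qed.

Lemma prC P A : measurable A -> pr P (~` A) = 1 - pr P A.
Proof.
move=> mA; apply: EFin_inj; rewrite EFinB -!prE //; last exact: measurableC.
exact: probability_setC.
Qed.

Lemma le_pr P A B : measurable A -> measurable B -> A `<=` B -> pr P A <= pr P B.
Proof. by move=> mA mB AB; rewrite -lee_fin -!prE // le_measure ?inE. Qed.

Lemma prT P : pr P setT = 1.
Proof. by rewrite /pr probability_setT. Qed.

Lemma prU P A B : measurable A -> measurable B -> A `&` B = set0 ->
  pr P (A `|` B) = pr P A + pr P B.
Proof.
move=> mA mB AB; apply: EFin_inj.
by rewrite EFinD -!prE ?measureU //; exact: measurableU.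
Qed.

Lemma pr_bigsum P (I : finType) (F : I -> set T) :
  (forall i, measurable (F i)) -> (forall i j, i != j -> F i `&` F j = set0) ->
  pr P [set x | exists i, F i x] = \sum_i pr P (F i).
Proof.
move=> mF dF.
have -> : [set x | exists i, F i x] = \big[setU/set0]_(i <- enum I) F i.
  rewrite -bigcup_seq; apply/seteqP; split=> x /=.
    by case=> i Fi; exists i => //=; rewrite mem_enum.
  by case=> i _ Fi; exists i.
rewrite -big_enum /=.
elim: (enum I) (enum_uniq I) => [|i s IH] /=.
  by rewrite !big_nil /pr measure0.
move=> /andP[nis us]; rewrite !big_cons prU ?IH //.
  by apply: bigsetU_measurable.
rewrite -bigcup_seq setI_bigcupr; apply/seteqP; split => x //= -[j /= js].
have ij : i != j by apply: contraNneq nis => ->.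
by have := dF i j ij; rewrite -subset0; exact.
Qed.

End Prob.

Section KL.
Local Open Scope ereal_scope.
Local Open Scope charge_scope.
Context d {T : measurableType d} {R : realType}.
Implicit Types m nu : probability T R.

(** [f] is not assumed integrable: it will be minus the logarithm of a density, whose integral may
    be infinite. Positive and negative parts are therefore compared separately. *)
Lemma le_integral_integrable m (D : set T) (f g : T -> \bar R) : measurable D ->
  measurable_fun D f -> m.-integrable D g -> (forall x, D x -> g x <= f x) ->
  \int[m]_(x in D) g x <= \int[m]_(x in D) f x.
Proof.
move=> mD mf ig gf; have mg := measurable_int _ ig.
have gf' : {in D, forall x, g x <= f x} by move=> x /set_mem; exact: gf.
rewrite [leLHS]integralE [leRHS]integralE; apply: leeB.
- apply: ge0_le_integral => //.
  + exact: measurable_funepos.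
  + exact: measurable_funepos.
  + by move=> x Dx; apply: (funepos_le gf'); exact/mem_set.
- apply: ge0_le_integral => //.
  + exact: measurable_funeneg.
  + exact: measurable_funeneg.
  + by move=> x Dx; apply: (funeneg_le gf'); exact/mem_set.
Qed.

Section Density.
Variables m nu : probability T R.
Hypothesis num : nu `<< m.

Let D := 'd (charge_of_finite_measure nu) '/d m.

Let Dfin x : D x \is a fin_num.
Proof. exact: Radon_Nikodym_fin_num. Qed.

Let iD : m.-integrable setT D.
Proof. exact: Radon_Nikodym_integrable. Qed.

Let DE A : measurable A -> \int[m]_(x in A) D x = nu A.
Proof.
by move=> mA; rewrite -(@Radon_Nikodym_integral _ _ _ (charge_of_finite_measure nu)).
Qed.

Let mlD A : measurable A -> measurable_fun A (fun x => - lne (D x)).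
Proof.
move=> mA; apply: measurableT_comp => //; apply: measurable_lne_comp => //.
by apply: measurable_funTS; exact: measurable_int iD.
Qed.

Lemma KL_split C : measurable C -> KL_divergence m nu =
  \int[m]_(x in C) (- lne (D x)) + \int[m]_(x in ~` C) (- lne (D x)).
Proof.
move=> mC; rewrite /KL_divergence -/D -{1}(setUv C) integral_setU //.
- exact: measurableC.
- by rewrite setUv; exact: mlD.
- exact/disj_setPCl.
Qed.

Lemma KL_part_ge C (s : R) : measurable C ->
  ((s + 1) * pr m C - expR s * pr nu C)%:E <= \int[m]_(x in C) (- lne (D x)).
Proof.
move=> mC.
have iDC : m.-integrable C D by exact: (integrableS measurableT).
have iC : m.-integrable C (cst (s + 1)%:E).
  exact: finite_measure_integrable_cst.
have iDC' : m.-integrable C (fun x => (expR s)%:E * D x) by exact: integrableZl.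
have <- : \int[m]_(x in C) ((s + 1)%:E - (expR s)%:E * D x) =
   ((s + 1) * pr m C - expR s * pr nu C)%:E.
  rewrite integralB //= integral_cst // integralZl //.
  rewrite DE // EFinB !EFinM -(prE nu mC); congr (_ * _ - _).
  exact: prE.
apply: le_integral_integrable => //; [exact: mlD|exact: integrableB|].
by move=> x _; exact: lne_tangent.
Qed.

(** A density is determined almost everywhere by its integrals over measurable subsets, so here it
    is the constant exp(-s) on [C]. *)
Lemma KL_part_eq C (s : R) : measurable C ->
  (forall A, measurable A -> A `<=` C -> pr nu A = (expR (- s) * pr m A)%R) ->
  \int[m]_(x in C) (- lne (D x)) = (s * pr m C)%:E.
Proof.
move=> mC H.
have aeD : ae_eq m C D (cst (expR (- s))%:E).
  apply: integral_ae_eq => //; first exact: (integrableS measurableT).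
  move=> A AC mA; rewrite integral_cst //.
  by rewrite DE // (prE nu mA) H // EFinM; congr (_ * _); exact/esym/prE.
rewrite (ae_eq_integral (cst s%:E)) // ?integral_cst //.
- by rewrite EFinM; congr (_ * _); exact: prE.
- exact: mlD.
- by apply: filterS aeD => x /= + Cx => ->//; rewrite lne_EFin ?expR_gt0 // expRK EFinN oppeK.
Qed.

(* The tangent inequality at dnu/dm = exp(-s) on C and exp(s) off C; hence an
   equality for the two-valued densities of KL_eq. *)
Lemma KL_ge C (s : R) : measurable C ->
  (1 + s * (2 * pr m C - 1) - expR s * pr nu C - expR (- s) * (1 - pr nu C))%:E
    <= KL_divergence m nu.
Proof.
move=> mC; have mC' := measurableC mC; rewrite (KL_split mC).
apply: le_trans (leeD (KL_part_ge s mC) (KL_part_ge (- s) mC')).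
rewrite -EFinD lee_fin !prC //; lra.
Qed.

Lemma KL_eq C (s : R) : measurable C ->
  (forall A, measurable A -> A `<=` C -> pr nu A = (expR (- s) * pr m A)%R) ->
  (forall A, measurable A -> A `<=` ~` C -> pr nu A = (expR s * pr m A)%R) ->
  KL_divergence m nu = (s * (2 * pr m C - 1))%:E.
Proof.
move=> mC H1 H2; have mC' := measurableC mC; rewrite (KL_split mC).
rewrite (KL_part_eq mC H1) (@KL_part_eq (~` C) (- s)) ?opprK //.
rewrite -EFinD prC //; congr EFin; ring.
Qed.

End Density.

End KL.

Section Letters.
Context {d : nat}.
Implicit Types (x y : letter d) (g : free_group d).

Definition fg_letter x : free_group d := @FreeGroup d [:: x] isT.

Lemma fg_letter_inj : injective fg_letter.
Proof. by move=> x y /(congr1 (@word d)) /= [->]. Qed.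

Lemma fg_letterV x : ((fg_letter x)^-1)%g = fg_letter (inv_letter x).
Proof. exact: val_inj. Qed.

Lemma generatorE (i : 'I_d) : generator i = fg_letter (i, false).
Proof. exact: val_inj. Qed.

Lemma reindex_inv_letter (V : nmodType) (F : letter d -> V) :
  \sum_x F (inv_letter x) = \sum_x F x.
Proof. by rewrite [RHS](reindex_inj (inv_inj (@inv_letterK d))). Qed.

Lemma supported_letter (R : realType) (mu : probability (free_group d) R) :
  supported_on_generators mu ->
  forall g, mu [set g] != 0%E -> exists x, g = fg_letter x.
Proof.
move=> H g g0; have /H : msupport mu g by rewrite /msupport /= lt0e g0 measure_ge0.
case=> i [->|->]; rewrite generatorE ?fg_letterV; by eexists.
Qed.

End Letters.

Section KLAction.
Context dX {X : measurableType dX} {R : realType}.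
Implicit Types nu : probability X R.

Lemma pr_distribution nu (a : {mfun X >-> X}) A :
  pr (distribution nu a) A = pr nu (a @^-1` A).
Proof. by []. Qed.

Lemma measurable_mfun_preimage (a : {mfun X >-> X}) A :
  measurable A -> measurable (a @^-1` A).
Proof. by move=> mA; rewrite -[X in measurable X]setTI; exact: measurable_funP. Qed.

Lemma KL_ge0 (m nu : probability X R) : nu `<< m -> (0 <= KL_divergence m nu)%E.
Proof.
move=> num; apply: (le_trans _ (KL_ge num 0 measurable0)).
by rewrite oppr0 expR0 lee_fin /pr !measure0 /=; lra.
Qed.

(** Think of [a] as a letter x, [b] as its inverse, [C] and [C'] as the cones of x and x^-1. For A
    inside [C], the set a^-1 A avoids [C'], and [h1] gives nu A = exp(-s) (a nu) A; for A outside
    [C], [h2] gives nu A = exp(s) (a nu) A. These two values of the density yield both absolute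
    continuity and the divergence. *)
Lemma KL_action nu (a b : {mfun X >-> X}) (C C' : set X) (s : R) :
  cancel a b -> cancel b a -> measurable C -> measurable C' ->
  (forall z, C (a z) <-> ~ C' z) ->
  (forall B, measurable B -> B `&` C' = set0 ->
    pr nu (b @^-1` B) = expR (- s) * pr nu B) ->
  (forall B, measurable B -> B `&` C = set0 ->
    pr nu (a @^-1` B) = expR (- s) * pr nu B) ->
  nu `<< distribution nu a /\
  KL_divergence (distribution nu a) nu = (s * (1 - 2 * pr nu C'))%:E.
Proof.
move=> ab ba mC mC' CC' h1 h2.
have E1 A : measurable A -> A `<=` C ->
    pr nu A = expR (- s) * pr (distribution nu a) A.
  move=> mA AC; rewrite pr_distribution -h1; last 2 first.
  - exact: measurable_mfun_preimage.
  - by apply/seteqP; split => z // -[/AC /CC'].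
  congr pr; apply/seteqP; split => z /=; by rewrite ba.
have E2 A : measurable A -> A `<=` ~` C ->
    pr nu A = expR s * pr (distribution nu a) A.
  move=> mA AC; rewrite pr_distribution h2 //.
    by rewrite mulrA -expRD subrr expR0 mul1r.
  by apply/seteqP; split => z // -[/AC].
have num : nu `<< distribution nu a.
  apply/null_content_dominatesP => A mA A0.
  have mAC := measurableI _ _ mA mC; have mAC' := measurableD mA mC.
  have zero B : measurable B -> B `<=` A -> pr (distribution nu a) B = 0.
    move=> mB BA; rewrite /pr (_ : _ B = 0%E) //.
    by apply/eqP; rewrite eq_le measure_ge0 andbT -A0 le_measure ?inE.
  rewrite prE // -(setUIDK A C) prU //; last first.
    by apply/seteqP; split => z // -[[_ ?] []].
  by rewrite (E1 (A `&` C)) // (E2 (A `\` C)) ?zero ?mulr0 ?addr0 // => z [].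
split => //.
rewrite (KL_eq num mC E1 E2); congr (_ * _)%:E.
rewrite pr_distribution (_ : a @^-1` C = ~` C'); last first.
  by apply/seteqP; split => z /= /CC'.
by rewrite prC //; ring.
Qed.

End KLAction.

Section EntropySum.
Context {d : nat} {R : realType} .
Variable lambda : probability (free_group d) R.
Hypothesis lambda_gen : supported_on_generators lambda.

Definition wt (x : letter d) : R := pr lambda [set fg_letter x].

(** Off the letters [lambda] vanishes and the product is 0 even where [K] is infinite, so the sign
    of [K] matters on letters only. *)
Lemma esum_letters (K : free_group d -> \bar R) :
  (forall x, 0 <= K (fg_letter x))%E ->
  (\esum_(g in [set: free_group d]) (lambda [set g] * K g) =
   \sum_x (wt x)%:E * K (fg_letter x))%E.
Proof.
move=> K0.
transitivity (\esum_(g in range (@fg_letter d)) (lambda [set g] * K g))%E.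
  rewrite [RHS]esum_mkcond; apply: eq_esum => g _; case: ifPn => // /negP gx.
  have [->|/(supported_letter lambda_gen)[x E]] := eqVneq (lambda [set g]) 0%E.
    by rewrite mul0e.
  by case: gx; apply/mem_set; exists x.
rewrite esum_fset //; last 2 first.
- exact: finite_image.
- by move=> _ /set_mem[x _ <-]; apply: mule_ge0.
rewrite fsbig_image //; last by move=> x y _ _; exact: fg_letter_inj.
transitivity (\sum_(i \in [set` enum {: letter d}])
  (lambda [set fg_letter i] * K (fg_letter i))%E).
  by apply: eq_fsbigl; apply/seteqP; split => x //= _; rewrite mem_enum.
rewrite -fsbig_seq ?enum_uniq // big_enum /=.
by apply: eq_bigr => x _; rewrite (prE lambda).
Qed.

End EntropySum.

(** * Entropy of an action with cones, common to the group and its boundary *)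

Section EntropyAction.
Context {d : nat} {R : realType} dX {X : measurableType dX}.
Variables (lambda : probability (free_group d) R).
Hypothesis lambda_gen : supported_on_generators lambda.
Hypothesis lambda_sym : symmetric_measure lambda.
Variables (act : free_group d -> {mfun X >-> X}) (C : letter d -> set X).
Variable s : letter d -> R.
Hypothesis actK : forall x, cancel (act (fg_letter x)) (act (fg_letter (inv_letter x))).
Hypothesis mC : forall x, measurable (C x).
Hypothesis actC : forall x z, C x (act (fg_letter x) z) <-> ~ C (inv_letter x) z.
Hypothesis sV : forall x, s (inv_letter x) = s x.
Variable nu : probability X R.

Lemma wt_inv x : wt lambda (inv_letter x) = wt lambda x.
Proof.
rewrite /wt -fg_letterV /pr -(lambda_sym [set fg_letter x]); congr (fine (lambda _)).
apply/seteqP; split=> g /=; first by move=> ->; rewrite invgK.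
by move=> <-; rewrite invgK.
Qed.

(** The preimage under x^-1 is the image under x: translating by x without cancellation multiplies
    masses by exp(-s_x). *)
Definition multiplicative := forall x B, measurable B -> B `&` C (inv_letter x) = set0 ->
  pr nu (act (fg_letter (inv_letter x)) @^-1` B) = expR (- s x) * pr nu B.

Lemma entropy_multiplicative : multiplicative ->
  entropy act lambda nu =
  (\sum_x wt lambda x * (s x * (1 - 2 * pr nu (C x))))%:E.
Proof.
move=> M.
have K x : nu `<< distribution nu (act (fg_letter x)) /\
    KL_divergence (distribution nu (act (fg_letter x))) nu =
    (s x * (1 - 2 * pr nu (C (inv_letter x))))%:E.
  apply: (KL_action (actK x)) (mC x) (mC _) (actC x) (M x) _ => //.
    by have := actK (inv_letter x); rewrite inv_letterK.
  by have := M (inv_letter x); rewrite inv_letterK sV.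
rewrite /entropy esum_letters //; last by move=> x; apply: KL_ge0; case: (K x).
rewrite (eq_bigr (fun x => (wt lambda (inv_letter x) * (s (inv_letter x) *
    (1 - 2 * pr nu (C (inv_letter x)))))%:E)); last first.
  by move=> x _; rewrite (K x).2 sV wt_inv.
rewrite sumEFin; congr EFin.
exact: (reindex_inv_letter (fun x => wt lambda x * (s x * (1 - 2 * pr nu (C x))))).
Qed.

(* The lower bound KL_ge involves both C x and C x^-1; averaging over x and x^-1
   leaves an expression that is affine in the masses of the C x. *)
Lemma entropy_ge : (forall x, nu `<< distribution nu (act (fg_letter x))) ->
  ((\sum_x wt lambda x * (1 + s x - expR (- s x)
     - pr nu (C x) * (2 * s x + expR (s x) - expR (- s x))))%:E
    <= entropy act lambda nu)%E.
Proof.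
move=> num.
rewrite /entropy esum_letters //; last by move=> x; exact: KL_ge0 (num x).
pose w x := pr nu (C x).
have K x : ((1 + s x * (1 - 2 * w (inv_letter x)) - expR (s x) * w x
    - expR (- s x) * (1 - w x))%:E
    <= KL_divergence (distribution nu (act (fg_letter x))) nu)%E.
  apply: le_trans (KL_ge (num x) (s x) (mC x)).
  rewrite lee_fin pr_distribution (_ : _ @^-1` C x = ~` C (inv_letter x)); last first.
    by apply/seteqP; split => z /= /actC.
  by rewrite prC // -!/(w _); lra.
apply: (@le_trans _ _ (\sum_x ((wt lambda x *
   (1 + s x * (1 - 2 * w (inv_letter x)) - expR (s x) * w x
    - expR (- s x) * (1 - w x)))%:E))%E); last first.
  by apply: lee_sum => x _; rewrite EFinM lee_wpmul2l // lee_fin pr_ge0.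
rewrite sumEFin lee_fin.
pose A x := wt lambda x * (1 + s x - expR (s x) * w x - expR (- s x) * (1 - w x)).
pose B x := wt lambda x * s x * (2 * w x).
rewrite (eq_bigr (fun x => A x - B x)); last by move=> x _; rewrite /A /B /w; ring.
rewrite [leRHS](eq_bigr (fun x => A x - B (inv_letter x))); last first.
  by move=> x _; rewrite /A /B /w sV wt_inv; ring.
by rewrite !sumrB lerD2l lerN2 (reindex_inv_letter B).
Qed.

End EntropyAction.

(** * The infimum over the group *)

Section Multiplier.
Context {R : realType}.
Implicit Types t y c : R.

(* Minus the derivative of (1 - 2 v) t with respect to v = 1 / (1 + exp t). *)
Definition kfun t : R := 2 * t + expR t - expR (- t).

Lemma kfunN t : kfun (- t) = - kfun t.
Proof. rewrite /kfun opprK; ring. Qed.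

(** This one estimate replaces differentiation: it gives the injectivity of [kfun], and the
    monotonicity and Lipschitz continuity of its inverse. *)
Lemma kfun_expand t t' : t <= t' -> 2 * (t' - t) <= kfun t' - kfun t.
Proof.
move=> tt'; have e1 : expR t <= expR t' by rewrite ler_expR.
have e2 : expR (- t') <= expR (- t) by rewrite ler_expR lerN2.
rewrite /kfun; lra.
Qed.

Lemma kfun0 : kfun 0 = 0.
Proof. by rewrite /kfun oppr0 mulr0 add0r subrr. Qed.

Lemma continuous_kfun : continuous kfun.
Proof.
move=> t; apply: cvgB; last first.
  apply: (@continuous_comp _ _ _ -%R expR); first exact: opp_continuous.
  exact: continuous_expR.
apply: cvgD; last exact: continuous_expR.
by apply: cvgM; [exact: cvg_cst|exact: cvg_id].
Qed.

Lemma kfun_surj y : exists t, kfun t = y.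
Proof.
have b t : 0 <= t -> t <= kfun t.
  by move=> t0; have := kfun_expand t0; rewrite kfun0; lra.
have ny := normr_ge0 y; have by' := b _ ny.
(* The interval is wide enough because [kfun] is odd and kfun t >= t for t >= 0. *)
have [|||t _ E] := @IVT _ kfun (- `|y|) `|y| y; last by exists t.
- lra.
- apply: continuous_subspaceT; exact: continuous_kfun.
have ly : y <= `|y| := ler_norm y.
have ly' : - y <= `|y| by rewrite -normrN ler_norm.
have le : - kfun `|y| <= kfun `|y| by lra.
by rewrite kfunN (min_idPl le) (max_idPr le); apply/andP; split; lra.
Qed.

Definition kinv y : R := projT1 (cid (kfun_surj y)).

Lemma kinvK y : kfun (kinv y) = y.
Proof. exact: projT2 (cid (kfun_surj y)). Qed.

Lemma kinv_lip y y' : `|kinv y - kinv y'| <= `|y - y'|.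
Proof.
wlog le : y y' / kinv y' <= kinv y.
  move=> H; have [le|/ltW le] := leP (kinv y') (kinv y); first exact: H.
  by rewrite distrC [leRHS]distrC; exact: H.
have := kfun_expand le; rewrite !kinvK => h.
rewrite ger0_norm ?subr_ge0 //; apply: le_trans (ler_norm _); lra.
Qed.

Lemma kinv_le y y' : y <= y' -> kinv y <= kinv y'.
Proof.
move=> le; rewrite leNgt; apply/negP => lt.
have := kfun_expand (ltW lt); rewrite !kinvK; lra.
Qed.

Lemma continuous_kinv : continuous kinv.
Proof.
move=> y; apply/cvgrPdist_lt => e e0; near=> z.
apply: le_lt_trans (kinv_lip _ _) _; near: z.
exact: (@cvgr_dist_lt _ _ _ (nbhs y) _ id y cvg_id).
Unshelve. all: by end_near. Qed.

(** For a fixed multiplier c the critical equations decouple, with solution kinv(c / lam x). Only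
    the scalar equation Th c = 1 remains, to which the intermediate value theorem applies. *)
Lemma lagrange_multiplier d (lam : letter d.+2 -> R) :
  (forall x, 0 < lam x <= 1) -> (forall x, lam (inv_letter x) = lam x) ->
  exists (c : R) (s : letter d.+2 -> R),
    [/\ forall x, 0 < s x, forall x, s (inv_letter x) = s x,
        forall x, lam x * kfun (s x) = c
      & \sum_x (1 + expR (s x))^-1 = 1].
Proof.
move=> lam0 lamV.
pose Th c : R := \sum_x (1 + expR (kinv (c / lam x)))^-1.
have cTh : continuous Th.
  move=> c; apply: cvg_big => [|x _]; [exact: add_continuous|apply: cvgV].
    by rewrite gt_eqF // addr_gt0 // expR_gt0.
  apply: cvgD; first exact: cvg_cst.
  apply: (@continuous_comp _ _ _ (fun c => kinv (c / lam x)) expR); last first.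
    exact: continuous_expR.
  apply: (@continuous_comp _ _ _ (fun c => c / lam x) kinv); last first.
    exact: continuous_kinv.
  by apply: cvgM; [exact: cvg_id|exact: cvg_cst].
pose N : R := #|{: letter d.+2}|%:R.
(* Rank at least 2 enters here: Th 0 = N / 2 exceeds 1, which keeps c, and hence every s_x, strictly
   positive. *)
have N4 : 4 <= N.
  rewrite /N card_prod card_ord card_bool ler_nat; lia.
have kinv0 : kinv 0 = 0.
  apply/eqP; rewrite eq_le; apply/andP; split; rewrite leNgt; apply/negP => lt.
    by have := kfun_expand (ltW lt); rewrite kinvK kfun0; lra.
  by have := kfun_expand (ltW lt); rewrite kinvK kfun0; lra.
have Th0 : Th 0 = N / 2.
  rewrite /Th (eq_bigr (fun => 2^-1)); last first.
    by move=> x _; rewrite mul0r kinv0 expR0.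
  by rewrite sumr_const -[LHS]mulr_natl.
have k0 : 0 <= kfun N.
  by have := @kfun_expand 0 N; rewrite kfun0; lra.
(* As lam x <= 1, the multiplier c = kfun N makes every s_x at least N, and each of the N terms is
   at most 1 / (1 + exp N) <= 1 / N. *)
have Th1 : Th (kfun N) <= 1.
  apply: (@le_trans _ _ (\sum_(x : letter d.+2) N^-1)).
    apply: ler_sum => x _; rewrite lef_pV2 ?posrE; last first.
    - lra.
    - by rewrite addr_gt0 // expR_gt0.
    apply: (@le_trans _ _ (1 + N)); first lra.
    rewrite lerD2l; apply: (@le_trans _ _ (expR N)).
      by apply: le_trans (expR_ge1Dx N); lra.
    rewrite ler_expR.
    suff {1}<- : kinv (kfun N) = N.
      apply: kinv_le; have /andP[l0 l1] := lam0 x.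
      by rewrite ler_pdivlMr // ler_piMr.
    apply/eqP; rewrite eq_le; apply/andP; split; rewrite leNgt; apply/negP => lt.
      by have := kfun_expand (ltW lt); rewrite kinvK; lra.
    by have := kfun_expand (ltW lt); rewrite kinvK; lra.
  rewrite sumr_const -mulr_natl -/N divff //; lra.
have [||c c0 E] := @IVT _ Th 0 (kfun N) 1 k0.
- exact: continuous_subspaceT.
- have le : Th (kfun N) <= Th 0 by rewrite Th0; lra.
  by rewrite (min_idPr le) (max_idPl le) Th0; apply/andP; split; lra.
have cpos : 0 < c.
  move: c0; rewrite in_itv /= => /andP[]; rewrite le_eqVlt => /predU1P[z|//] _.
  by move: E; rewrite -z Th0; lra.
exists c, (fun x => kinv (c / lam x)); split => //.
- move=> x; rewrite ltNge; apply/negP => le.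
  have /andP[l0 _] := lam0 x.
  have := kfun_expand le; rewrite kinvK kfun0.
  have : 0 < c / lam x by rewrite divr_gt0.
  lra.
- by move=> x; rewrite lamV.
- move=> x; rewrite kinvK mulrCA divff ?mulr1 //.
  by have /andP[l0 _] := lam0 x; rewrite gt_eqF.
Qed.

End Multiplier.

Section EsumScale.
Local Open Scope ereal_scope.
Context {R : realType} {T : choiceType}.

Let esumZl_le (c : R) (I : set T) (a : T -> \bar R) : (0 < c)%R ->
  (forall i, 0 <= a i) ->
  \esum_(i in I) (c%:E * a i) <= c%:E * \esum_(i in I) a i.
Proof.
move=> c0 a0; apply: ge_ereal_sup => _ [F [fF FI] <-].
rewrite -ge0_mule_fsumr //; apply: lee_wpmul2l; first by rewrite lee_fin ltW.
by apply: ereal_sup_ubound; exists F.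
Qed.

Lemma esumZl (c : R) (I : set T) (a : T -> \bar R) : (0 < c)%R ->
  (forall i, 0 <= a i) ->
  \esum_(i in I) (c%:E * a i) = c%:E * \esum_(i in I) a i.
Proof.
move=> c0 a0; apply/eqP; rewrite eq_le esumZl_le //=.
have ca i : 0 <= c%:E * a i by apply: mule_ge0 => //; rewrite lee_fin ltW.
have ci : (0 < c^-1)%R by rewrite invr_gt0.
have := esumZl_le I ci ca.
under eq_esum do rewrite muleA -EFinM mulVf ?gt_eqF // mul1e.
move=> h; have := lee_wpmul2l (ltW c0 : 0 <= c%:E) h.
by rewrite muleA -EFinM mulfV ?gt_eqF // mul1e.
Qed.

End EsumScale.

(** * Cones in the group and multiplicative measures on it *)

Section Starts.
Context {d : nat}.
Implicit Types (x y : letter d) (g : free_group d).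

Definition starts x : set (free_group d) := [set g | ohead (word g) = Some x].

Lemma word_letter_mul x g : word (fg_letter x * g)%g = push x (word g).
Proof. by []. Qed.

Lemma letter_mulK x g : (fg_letter (inv_letter x) * (fg_letter x * g))%g = g.
Proof. by rewrite -fg_letterV mulKg. Qed.

Lemma letter_mulVK x g : (fg_letter x * (fg_letter (inv_letter x) * g))%g = g.
Proof. by rewrite -{1}[x]inv_letterK letter_mulK. Qed.

(** If x cancels the first letter x^-1 of g, the next letter of g is not x, because g is reduced. *)
Lemma starts_mul x g : starts x (fg_letter x * g)%g <-> ~ starts (inv_letter x) g.
Proof.
rewrite /starts /= -/(push x (word g)).
have := word_reduced g; case: (word g) => [|y w] //= rw.
case: ifPn => [/eqP E | yx]; last first.
  by split => // _ [] E; rewrite E eqxx in yx.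
split; last by rewrite E => /(_ erefl).
move: rw; rewrite E; case: w => [|z w] // /andP[+ _] [zx].
by rewrite zx inv_letterK eqxx.
Qed.

Lemma starts_inj x y g : starts x g -> starts y g -> x = y.
Proof. by rewrite /starts /= => -> []. Qed.

End Starts.

Section WordMass.
Context {d : nat} {R : realType}.
Variable f : letter d -> R.
Hypothesis f01 : forall x, 0 < f x < 1.
Hypothesis fV : forall x, f (inv_letter x) = f x.
Implicit Types (x y : letter d) (g : free_group d) (A : set (free_group d)).

Let f_gt0 x : 0 < f x. Proof. by have /andP[] := f01 x. Qed.

Definition word_weight g : R := \prod_(x <- word g) f x.

Lemma word_weight_gt0 g : 0 < word_weight g.
Proof. by apply: prodr_gt0 => x _. Qed.

Lemma word_weight_mul x g : ~ starts (inv_letter x) g ->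
  word_weight (fg_letter x * g)%g = f x * word_weight g.
Proof.
rewrite /word_weight word_letter_mul /starts /=; case: (word g) => [|y w] /=.
  by rewrite big_seq1 big_nil mulr1.
by case: ifPn => [/eqP -> //|] _ _; rewrite !big_cons.
Qed.

Definition word_mass A : \bar R := (\esum_(g in A) (word_weight g)%:E)%E.

Let word_mass0 : word_mass set0 = 0%E.
Proof. exact: esum_set0. Qed.

Let word_mass_ge0 A : (0 <= word_mass A)%E.
Proof. by apply: esum_ge0 => g _; rewrite lee_fin ltW // word_weight_gt0. Qed.

Let word_mass_sigma_additive : semi_sigma_additive word_mass.
Proof.
move=> F mF tF _; rewrite /word_mass nneseries_sum_bigcup //; last first.
  by move=> g; rewrite lee_fin ltW // word_weight_gt0.
by apply: is_cvg_nneseries => n _ _; exact: word_mass_ge0.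
Qed.

HB.instance Definition _ := isMeasure.Build _ _ _ word_mass
  word_mass0 word_mass_ge0 word_mass_sigma_additive.

Lemma word_mass_mul x A : A `&` starts (inv_letter x) = set0 ->
  word_mass (left_translation (fg_letter (inv_letter x)) @^-1` A) =
  ((f x)%:E * word_mass A)%E.
Proof.
move=> A0; rewrite /word_mass.
rewrite (@reindex_esum _ _ _ A _ (left_translation (fg_letter x))); last first.
  split.
  - by move=> g Ag /=; rewrite /left_translation letter_mulK.
  - by move=> g h _ _; exact: mulgI.
  - move=> g /= Ag; exists (fg_letter (inv_letter x) * g)%g => //.
    by rewrite /left_translation letter_mulVK.
rewrite -esumZl //; last by move=> g; rewrite lee_fin ltW // word_weight_gt0.
apply: eq_esum => g Ag; rewrite -EFinM word_weight_mul // => sg.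
by have : (A `&` starts (inv_letter x)) g by []; rewrite A0.
Qed.

Lemma word_mass1 : word_mass [set 1%g] = 1%E.
Proof.
by rewrite /word_mass esum_set1 ?lee_fin ?ltW ?word_weight_gt0 // /word_weight big_nil.
Qed.

Hypothesis f_sum : \sum_x f x / (1 + f x) < 1.

(** After normalization [u x] is the mass of the cone of x and [u0] that of the empty word; [f_sum]
    says that the latter is positive. *)
Let u x := f x / (1 + f x).
Let u0 := 1 - \sum_x u x.
Let ball n : set (free_group d) := [set g | (size (word g) <= n)%N].

Let u0_gt0 : 0 < u0. Proof. by rewrite subr_gt0. Qed.

Let u_gt0 x : 0 < u x.
Proof. by rewrite divr_gt0 // addr_gt0. Qed.

Lemma word_cases g : g = 1%g \/ exists x, starts x g.
Proof.
rewrite /starts /=; case E: (word g) => [|x w]; last by right; exists x.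
by left; apply: val_inj.
Qed.

(** Removing the first letter x of a word leaves the empty word or a word starting with some y !=
    x^-1. This is the resulting system for the masses of the cones. *)
Let u_rec x : f x * (1 + \sum_(y | y != inv_letter x) u y / u0) = u x / u0.
Proof.
rewrite -mulr_suml.
have -> : \sum_(y | y != inv_letter x) u y = 1 - u0 - u x.
  rewrite /u0 [in RHS](bigD1 (inv_letter x)) //= {2}/u fV -/(u x); ring.
have n0 : u0 != 0 by rewrite gt_eqF.
have n1 : 1 + f x != 0 by rewrite gt_eqF // addr_gt0.
by rewrite /u; field; rewrite n0 n1.
Qed.

(* u x / u0 turns out to be the exact mass of the words starting with x. *)
Let ball_mass n x : (word_mass (ball n `&` starts x) <= (u x / u0)%:E)%E.
Proof.
elim: n x => [|n IH] x.
  have uu : 0 <= u x / u0 by rewrite ltW // divr_gt0.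
  rewrite (_ : _ `&` _ = set0) ?measure0 ?lee_fin //.
  by apply/seteqP; split => // g []; rewrite /ball /starts /= leqn0 size_eq0 => /eqP ->.
(* Words of length at most n + 1 starting with x are the products x g with g of length at most n not
   starting with x^-1. *)
pose B := ball n `\` starts (inv_letter x).
have -> : ball n.+1 `&` starts x =
    left_translation (fg_letter (inv_letter x)) @^-1` B.
  apply/seteqP; split => g; rewrite /B /ball /left_translation /=.
    move=> [sg xg]; split; last first.
      by apply/starts_mul; rewrite inv_letterK.
    move: xg sg; rewrite /starts /=.
    by case: (word g) => //= y w [->]; rewrite inv_letterK eqxx.
  move=> [sg]; rewrite starts_mul inv_letterK => /contrapT xg; split => //.
  move: xg sg; rewrite /starts /=.
  by case: (word g) => //= y w [->]; rewrite inv_letterK eqxx.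
rewrite word_mass_mul; last by apply/seteqP; split => g // -[[]].
rewrite -u_rec EFinM; apply: lee_wpmul2l; first by rewrite lee_fin ltW.
pose F (y : letter d) := if y == inv_letter x then set0 else ball n `&` starts y.
apply: (@le_trans _ _ (word_mass ([set 1%g] `|` \big[setU/set0]_y F y))).
  apply: le_measure; rewrite ?inE // => g [gn gx].
  have [->|[y yg]] := word_cases g; [by left|right].
  rewrite -bigcup_seq; exists y; first by rewrite /= mem_index_enum.
  by rewrite /F; case: ifPn => // /eqP E; rewrite E in yg.
apply: le_trans; first exact: measureU2.
rewrite EFinD; apply: leeD; first by rewrite -[leRHS]word_mass1.
apply: (@le_trans _ _ (\sum_y word_mass (F y))%E).
  elim/big_ind2 : _ => [|A a B' b Aa Bb|//]; first by rewrite measure0.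
  by apply: le_trans; [exact: measureU2|exact: leeD].
rewrite [X in (_ <= X%:E)%E]big_mkcond /= -sumEFin; apply: lee_sum => y _; rewrite /F.
by case: eqP => _ /=; [rewrite [leLHS]word_mass0|exact: IH].
Qed.

(** The system [u_rec] alone does not exclude infinite masses; hence the truncation to balls, where
    the bounds of [ball_mass] are uniform in the radius and pass to the union. *)
Lemma word_mass_finite : (word_mass setT < +oo)%E.
Proof.
have bT : \bigcup_n ball n = setT.
  by apply/seteqP; split => // g _; exists (size (word g)) => //=; rewrite /ball /=.
have := @nondecreasing_cvg_mu _ _ _ word_mass ball (fun=> I) I _.
rewrite bT => /(_ _)/cvg_lim <- //; last first.
  by move=> m n mn; apply/subsetPset => g /leq_trans; apply.
apply: (@le_lt_trans _ _ (1 + \sum_x u x / u0)%:E); last exact: ltry.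
apply: lime_le.
  apply/cvg_ex; exists (word_mass (\bigcup_n ball n)).
  apply: nondecreasing_cvg_mu => // m n mn.
  by apply/subsetPset => g /leq_trans; apply.
near=> n => /=.
apply: (@le_trans _ _ (word_mass ([set 1%g] `|`
    \big[setU/set0]_x (ball n `&` starts x)))).
  apply: le_measure; rewrite ?inE // => g gn.
  have [->|[y yg]] := word_cases g; [by left|right].
  by rewrite -bigcup_seq; exists y => //; rewrite /= mem_index_enum.
apply: le_trans; first exact: measureU2.
rewrite EFinD; apply: leeD; first by rewrite -[leRHS]word_mass1.
rewrite -sumEFin.
elim/big_ind2 : _ => [|A a B' b Aa Bb|x _]; first by rewrite measure0.
  by apply: le_trans; [exact: measureU2|exact: leeD].
exact: ball_mass.
Unshelve. all: by end_near. Qed.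

Lemma multiplicative_measure_exists : exists eta : probability (free_group d) R,
  [/\ forall g, (0 < eta [set g])%E,
      forall x A, A `&` starts (inv_letter x) = set0 ->
        pr eta (left_translation (fg_letter (inv_letter x)) @^-1` A) = f x * pr eta A
    & forall x, pr eta (starts x) = f x / (1 + f x)].
Proof.
pose Z := fine (word_mass setT).
have ZE : word_mass setT = Z%:E.
  by rewrite fineK // ge0_fin_numE // word_mass_finite.
have wg g : word_mass [set g] = (word_weight g)%:E.
  by rewrite /word_mass esum_set1 // lee_fin ltW // word_weight_gt0.
have Z0 : 0 < Z.
  rewrite -lte_fin -ZE; apply: (@lt_le_trans _ _ (word_mass [set 1%g])).
    by rewrite wg lte_fin word_weight_gt0.
  by apply: le_measure; rewrite ?inE.
(* The Dirac mass is only the default of [mnormalize] for total mass 0 or +oo, excluded by [Z0] and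
   [ZE]. *)
pose eta : probability (free_group d) R := mnormalize word_mass (\d_ (1%g : free_group d)).
have etaE A : eta A = (Z^-1%:E * word_mass A)%E.
  rewrite /eta /= /mnormalize /=; case: ifPn => [|_]; last by rewrite muleC.
  case/orP => /eqP /(etrans (esym ZE)) // -[Z00].
  by move: Z0; rewrite Z00 ltxx.
have etaM x A : A `&` starts (inv_letter x) = set0 ->
  pr eta (left_translation (fg_letter (inv_letter x)) @^-1` A) = f x * pr eta A.
  move=> A0; apply: EFin_inj; rewrite EFinM -!prE // !etaE word_mass_mul //.
  by rewrite muleCA.
exists eta; split => //.
- by move=> g; rewrite etaE wg -EFinM lte_fin mulr_gt0 ?invr_gt0 ?word_weight_gt0.
- pose a x := pr eta (starts x).
  (* Left multiplication by x maps the words not starting with x^-1 onto those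
     starting with x. *)
  have aE x : a x = f x * (1 - a (inv_letter x)).
    rewrite -prC // -etaM; last by apply/seteqP; split => g // [].
    congr pr; apply/seteqP; split => g /=.
      by move=> xg; apply/starts_mul; rewrite inv_letterK.
    by rewrite /left_translation starts_mul inv_letterK => /contrapT.
  move=> x; rewrite -/(a x).
  (* The equations for x and x^-1 combine to a (1 - f^2) = f (1 - f), and f < 1 allows the
     division. *)
  have := aE x; rewrite (aE (inv_letter x)) inv_letterK fV.
  have /andP[f0 f1] := f01 x => E.
  have n1 : 1 + f x != 0 by rewrite gt_eqF // addr_gt0.
  have n2 : 1 - f x != 0 by rewrite gt_eqF // subr_gt0.
  apply: (mulIf (mulf_neq0 n1 n2)).
  have -> : a x * ((1 + f x) * (1 - f x)) = f x * (1 - f x) by lra.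
  by field.
Qed.

End WordMass.

(** * The value of the infimum *)

Section InfEntropy.
Context {d : nat} {R : realType}.
Variables (lambda : probability (free_group d.+1) R).
Hypothesis lambda_gen : supported_on_generators lambda.
Hypothesis lambda_sym : symmetric_measure lambda.
Variables (c : R) (s : letter d.+1 -> R).
Hypothesis s_gt0 : forall x, 0 < s x.
Hypothesis sV : forall x, s (inv_letter x) = s x.
Hypothesis s_crit : forall x, wt lambda x * kfun (s x) = c.
Hypothesis s_sum : \sum_x (1 + expR (s x))^-1 = 1.

Let act := fun g : free_group d.+1 =>
  (left_translation g : {mfun free_group d.+1 >-> free_group d.+1}).

Let actK x : cancel (act (fg_letter x)) (act (fg_letter (inv_letter x))).
Proof. move=> g; exact: letter_mulK. Qed.

Let e1_gt0 t : 0 < 1 + expR t :> R.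
Proof. by rewrite addr_gt0 // expR_gt0. Qed.

Definition min_entropy : R := \sum_x wt lambda x * (s x * (1 - 2 * (1 + expR (s x))^-1)).

(** The bound of [entropy_ge] is an equality at the masses v_x = 1 / (1 + exp s_x), where the
    tangent points are the true densities. By [s_crit] its part linear in v is then c times the sum
    of the v_x, that is c. *)
Let min_entropyE :
  min_entropy = \sum_x wt lambda x * (1 + s x - expR (- s x)) - c.
Proof.
rewrite -[c]mulr1 -[X in c * X]s_sum mulr_sumr -sumrB; apply: eq_bigr => x _.
rewrite -(s_crit x) /kfun -mulrA -mulrBr; congr (_ * _).
have n0 : 1 + expR (s x) != 0 by rewrite gt_eqF.
rewrite expRN; have := expR_gt0 (s x); set e := expR (s x) in n0 * => e0.
have n1 : e != 0 by rewrite gt_eqF.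
by field; rewrite n0 n1.
Qed.

Lemma group_entropy_ge (eta : probability (free_group d.+1) R) :
  (forall g, 0 < eta [set g])%E -> (min_entropy%:E <= group_entropy lambda eta)%E.
Proof.
move=> eta0.
apply: (@le_trans _ _ (\sum_x wt lambda x * (1 + s x - expR (- s x)
     - pr eta (starts x) * (2 * s x + expR (s x) - expR (- s x))))%:E); last first.
  apply: (@entropy_ge _ _ _ _ lambda lambda_gen lambda_sym act starts s) => //.
    by move=> x g; exact: starts_mul.
  (* All points have positive mass, so only the empty set is null for a translate of [eta]. *)
  move=> x; apply/null_content_dominatesP => A _ A0.
  have [-> | /set0P[g Ag]] := eqVneq A set0.
    by rewrite measure0.
  suff : (0 < distribution eta (act (fg_letter x)) A)%E by rewrite A0 ltxx.
  apply: (lt_le_trans (eta0 (fg_letter (inv_letter x) * g)%g)).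
  apply: le_measure; rewrite ?inE // => h /= ->.
  by rewrite /act /= /left_translation letter_mulVK.
rewrite lee_fin min_entropyE.
rewrite [leRHS](eq_bigr (fun x => wt lambda x * (1 + s x - expR (- s x))
  - c * pr eta (starts x))); last first.
  by move=> x _; rewrite -(s_crit x) /kfun; ring.
(* The masses now enter only through - c times their sum: c >= 0 because s > 0, and the sum is at
   most 1 because the cones are disjoint. *)
rewrite sumrB lerD2l lerN2 -mulr_sumr ler_piMr //.
  rewrite -(s_crit (ord0, false)) mulr_ge0 ?pr_ge0 //.
  have := kfun_expand (ltW (s_gt0 (ord0, false))); rewrite kfun0.
  have := s_gt0 (ord0, false); lra.
rewrite -pr_bigsum //; first exact: pr_le1.
move=> x y xy; apply/seteqP; split => // g [xg yg].
by move: xy; rewrite (starts_inj xg yg) eqxx.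
Qed.

Let sig t : R := (1 + expR t)^-1.

Let sig_gt0 t : 0 < sig t. Proof. by rewrite invr_gt0. Qed.

(** The difference factors as 1 - exp(-e), which is at most e, times two factors in [0, 1]. *)
Let sig_lip t (e : R) : 0 <= e -> sig t - sig (t + e) <= e.
Proof.
move=> e0.
have E : sig t - sig (t + e) =
    (1 - expR (- e)) * (expR (t + e) * sig (t + e)) * sig t.
  rewrite /sig; set a := expR (t + e); have -> : expR t = expR (- e) * a.
    by rewrite -expRD addrCA addNr addr0.
  have n1 : 1 + a != 0 by rewrite gt_eqF // e1_gt0.
  have n2 : 1 + expR (- e) * a != 0.
    by rewrite gt_eqF // addr_gt0 // mulr_gt0 // expR_gt0.
  by field; rewrite n1 n2.
rewrite E.
have h1 : 0 <= 1 - expR (- e) by rewrite subr_ge0 -expR0 ler_expR oppr_le0.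
have h2 : 1 - expR (- e) <= e by have := expR_ge1Dx (- e); lra.
have h3 : expR (t + e) * sig (t + e) <= 1.
  by rewrite /sig ler_pdivrMr // mul1r; lra.
have h4 : sig t <= 1.
  by rewrite /sig invf_le1 //; have := expR_gt0 t; lra.
have h5 : 0 <= expR (t + e) * sig (t + e).
  by rewrite mulr_ge0 ?expR_ge0 // ltW.
rewrite -mulrA; apply: le_trans h2; apply: ler_piMr => //.
by rewrite mulr_ile1 // ltW.
Qed.

(** The shift by e makes the sum in [f_sum] strictly less than 1; at e = 0 it would equal 1 by
    [s_sum]. *)
Lemma group_entropy_le (e : R) : 0 < e ->
  exists eta : probability (free_group d.+1) R,
    (forall g, 0 < eta [set g])%E /\
    (group_entropy lambda eta <=
      (min_entropy + e * (\sum_x wt lambda x * (1 + 2 * s x)))%:E)%E.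
Proof.
move=> e0; pose f x := expR (- (s x + e)).
have fE x : f x / (1 + f x) = sig (s x + e).
  rewrite /f /sig expRN; have := expR_gt0 (s x + e); set a := expR _ => a0.
  have n1 : a != 0 by rewrite gt_eqF.
  have n2 : 1 + a != 0 by rewrite gt_eqF // addr_gt0.
  by field; rewrite n1 ?n2 ?[a + 1]addrC ?n2.
have sig_lt x : sig (s x + e) < sig (s x).
  by rewrite ltf_pV2 ?posrE // ltrD2l ltr_expR ltrDl.
have [|x||eta [eta0 etaM etaS]] := @multiplicative_measure_exists _ R f.
- by move=> x; rewrite expR_gt0 expR_lt1 oppr_lt0 addr_gt0.
- by rewrite /f sV.
- rewrite (eq_bigr _ (fun x _ => fE x)) -[ltRHS]s_sum.
  apply: ltr_sum => //; apply/hasP; exists (ord0, false) => //.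
  exact: mem_index_enum.
exists eta; split => //.
rewrite /group_entropy (@entropy_multiplicative _ _ _ _ lambda _ _ act starts
   (fun x => s x + e)) //.
(* With v and v' the values of [sig] at s and s + e, the excess of a term is 2 s (v - v') + e (1 - 2
   v'), at most e (1 + 2 s) as v - v' <= e. *)
- rewrite lee_fin mulr_sumr -big_split /=; apply: ler_sum => x _.
  rewrite [e * _]mulrCA -mulrDr; apply: ler_wpM2l; first exact: pr_ge0.
  rewrite etaS fE -/(sig (s x)).
  have := sig_lip (s x) (ltW e0); have := sig_gt0 (s x + e).
  set v := sig (s x); set v' := sig (s x + e) => v0 lip.
  have h1 : 0 <= 2 * s x * (e - (v - v')).
    by rewrite mulr_ge0 ?subr_ge0 // mulr_ge0 // ltW.
  have h2 : 0 <= e * (2 * v') by rewrite !mulr_ge0 // ltW.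
  lra.
- by move=> x g; exact: starts_mul.
- by move=> x; rewrite sV.
- by move=> x A _; exact: etaM.
Qed.

Lemma inf_entropyE : inf_entropy lambda = min_entropy%:E.
Proof.
apply/eqP; rewrite eq_le; apply/andP; split; last first.
  by apply/ereal_infP => _ [eta eta0 <-]; exact: group_entropy_ge.
apply/lee_addgt0Pr => e e0.
pose K := \sum_x wt lambda x * (1 + 2 * s x).
have K0 : 0 <= K.
  apply: sumr_ge0 => x _; rewrite mulr_ge0 ?pr_ge0 // addr_ge0 // mulr_ge0 // ltW //.
have K1 : 0 < K + 1 by lra.
have [eta [eta0 le]] := @group_entropy_le (e / (K + 1)) (divr_gt0 e0 K1).
apply: (@le_trans _ _ (group_entropy lambda eta)).
  by apply: ereal_inf_lbound; exists eta.
apply: (le_trans le); rewrite -EFinD lee_fin lerD2l -/K.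
rewrite mulrAC ler_pdivrMr // ler_pM2l //; lra.
Qed.

End InfEntropy.

(** * The random walk and its limit *)

Section UnitInterval.
Context {R : realType}.
Local Notation leb := (@lebesgue_measure R).

Let affine (a p x : R) : measurableTypeR R := (x - a) / p.

Let measurable_affine a p :
  measurable_fun setT (affine a p : measurableTypeR R -> measurableTypeR R).
Proof.
by apply: continuous_measurable_fun => x; apply: cvgM;
  [apply: cvgB; [exact: cvg_id|exact: cvg_cst]|exact: cvg_cst].
Qed.

(** The pushforward of [leb] under the affine map, divided by p, agrees with [leb] on half-open
    intervals, and these determine it. *)
Lemma lebesgue_affine (a p : R) (A : set (measurableTypeR R)) : 0 < p -> measurable A ->
  leb ((fun x => (x - a) / p) @^-1` A) = (p%:E * leb A)%E.
Proof.
move=> p0 mA; have pi : 0 <= p^-1 by rewrite invr_ge0 ltW.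
pose pushed : {measure set (measurableTypeR R) -> \bar R} :=
  mscale (NngNum pi) (pushforward leb (affine a p)).
pose m := pushed (measurable_affine a p).
have mE B : m B = (p^-1%:E * leb (affine a p @^-1` B))%E by [].
have -> : leb A = m A.
  apply: lebesgue_measure_unique => // B /ocitvP[->|[[u v] /= uv ->]].
    by rewrite !measure0.
  rewrite mE (_ : _ @^-1` _ = `]a + p * u, a + p * v]%classic); last first.
    apply/seteqP; split => x; rewrite /affine /= !in_itv /=.
      by rewrite ltr_pdivlMr // ler_pdivrMr // => /andP[h1 h2]; apply/andP; split; lra.
    by rewrite ltr_pdivlMr // ler_pdivrMr // => /andP[h1 h2]; apply/andP; split; lra.
  rewrite !lebesgue_measure_itv /= !lte_fin uv ltrD2l ltr_pM2l // uv.
  rewrite -!EFinB -EFinM; congr EFin; field; by rewrite gt_eqF.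
by rewrite mE muleA -EFinM divff ?gt_eqF // mul1e.
Qed.

Let unit_itv : set (measurableTypeR R) := `[0, 1[%classic.

Let measurable_unit_itv : measurable unit_itv.
Proof. exact: measurable_itv. Qed.

Definition uniform01 : probability (measurableTypeR R) R :=
  mnormalize (mrestr leb measurable_unit_itv) (\d_ (0 : measurableTypeR R)).

Lemma uniform01E A : measurable A -> uniform01 A = leb (A `&` `[0, 1[%classic).
Proof.
move=> mA; rewrite /uniform01 /= /mnormalize /=.
have E : mrestr leb measurable_unit_itv setT = 1%E.
  by rewrite /mrestr setTI lebesgue_measure_itv /= lte_fin ltr01 -EFinB subr0.
rewrite E /= onee_eq0 /= invr1 mule1.
by [].
Qed.

(* Cut [0, 1[ into consecutive intervals of lengths p x; sigma names the interval
   and T maps it affinely onto [0, 1[. *)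
Lemma bernoulli_shift (I : finType) (x0 : I) (p : I -> R) :
  (forall x, 0 < p x) -> \sum_x p x = 1 ->
  exists (sigma : measurableTypeR R -> I) (T : measurableTypeR R -> measurableTypeR R),
    [/\ forall x, measurable (sigma @^-1` [set x]),
        measurable_fun setT T
      & forall x B, measurable B ->
        pr uniform01 (sigma @^-1` [set x] `&` T @^-1` B) = p x * pr uniform01 B].
Proof.
move=> p0 p1; pose e := enum I; pose n := size e.
pose c (k : nat) : R := \sum_(y <- take k e) p y.
pose a x := c (index x e).
have cS x : c (index x e).+1 = a x + p x.
  have ix : (index x e < size e)%N by rewrite index_mem mem_enum.
  by rewrite /a /c (take_nth x0) // -cats1 big_cat /= big_seq1 nth_index // mem_enum.
have c_mono i j : (i <= j)%N -> c i <= c j.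
  move=> ij; rewrite /c -(cat_take_drop i (take j e)) big_cat /= -take_min (minn_idPl ij) lerDl.
  by apply: sumr_ge0 => y _; rewrite ltW.
have c0 : c 0%N = 0 by rewrite /c take0 big_nil.
have cn : c n = 1 by rewrite /c take_size big_enum.
pose J x : set R := `[a x, a x + p x[%classic.
have JP x w : J x w <-> a x <= w < a x + p x by rewrite /J /= in_itv.
have J_inj x y w : J x w -> J y w -> x = y.
  wlog xy : x y / (index x e <= index y e)%N.
    move=> H; have [le|/ltnW le] := leqP (index x e) (index y e); first exact: H.
    by move=> Jx Jy; apply/esym/H.
  move=> /JP /andP[_ h1] /JP /andP[h2 _].
  move: xy; rewrite leq_eqVlt => /orP[/eqP E|lt].
    by rewrite -(@nth_index _ x0 x e) ?mem_enum // E nth_index // mem_enum.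
  by exfalso; have := c_mono _ _ lt; rewrite cS -/(a y); lra.
have J_cover w : 0 <= w < 1 -> exists x, J x w.
  move=> /andP[w0 w1].
  have ex : exists k, w < c k by exists n; rewrite cn.
  case: (ex_minnP ex) => -[|k] wk kmin; first by move: wk; rewrite c0; lra.
  have kn : (k < n)%N by have := kmin n; rewrite cn => /(_ w1).
  exists (nth x0 e k); apply/JP.
  have ik : index (nth x0 e k) e = k by rewrite index_uniq // enum_uniq.
  rewrite -cS ik wk andbT /a ik leNgt; apply/negP => /kmin.
  by rewrite ltnn.
have J_sub x w : J x w -> 0 <= w < 1.
  move=> /JP /andP[h1 h2]; apply/andP; split.
    by apply: le_trans h1; rewrite -c0; exact: c_mono.
  apply: (lt_le_trans h2); rewrite -cS -cn; apply: c_mono.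
  by rewrite index_mem mem_enum.
(* Outside [0, 1[, a null set for [uniform01], [sigma] takes the default value [x0]; hence the
   separate case of [x0] in [msigma]. *)
pose sigma (w : measurableTypeR R) : I := xget x0 [set x | J x w].
have sigma_J x w : J x w -> sigma w = x.
  move=> Jx; rewrite /sigma; case: xgetP => [y -> /= Jy|/(_ x)//].
  exact: J_inj Jy Jx.
have sigmaE x : sigma @^-1` [set x] `&` unit_itv = J x.
  apply/seteqP; split => w.
    move=> [/= sw]; rewrite /unit_itv /= in_itv /= => /J_cover[y Jy].
    by rewrite -sw (sigma_J _ _ Jy).
  by move=> Jx; split; [exact: sigma_J|rewrite /unit_itv /= in_itv; exact: J_sub Jx].
have mJ x : measurable (J x : set (measurableTypeR R)) by exact: measurable_itv.
have msigma x : measurable (sigma @^-1` [set x]).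
  have [->|xx0] := eqVneq x x0; last first.
    rewrite (_ : _ @^-1` _ = J x) //; apply/seteqP; split => w /=; last exact: sigma_J.
    rewrite /sigma; case: xgetP => [y -> /= Jy <-//|_ E].
    by rewrite E eqxx in xx0.
  rewrite (_ : _ @^-1` _ = J x0 `|` ~` unit_itv).
    by apply: measurableU => //; exact: measurableC.
  apply/seteqP; split => w /=.
    move=> sw; have [u|nu] := pselect (unit_itv w); [left|by right].
    by have : (sigma @^-1` [set x0] `&` unit_itv) w by []; rewrite sigmaE.
  case; first exact: sigma_J.
  move=> nu; rewrite /sigma; case: xgetP => [y _ /= /J_sub Jy|//].
  by case: nu; rewrite /unit_itv /= in_itv.
pose T (w : measurableTypeR R) : measurableTypeR R := affine (a (sigma w)) (p (sigma w)) w.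
have TE x B : sigma @^-1` [set x] `&` T @^-1` B =
    sigma @^-1` [set x] `&` affine (a x) (p x) @^-1` B.
  by apply/seteqP; split => w [/= sw]; rewrite /T sw.
have mA x B : measurable B -> measurable (affine (a x) (p x) @^-1` B).
  by move=> mB; have := measurable_affine (a x) (p x) measurableT mB; rewrite setTI.
exists sigma, T; split => //.
- move=> _ B mB; rewrite setTI.
  have -> : T @^-1` B =
      \bigcup_(x in [set: I]) (sigma @^-1` [set x] `&` affine (a x) (p x) @^-1` B).
    apply/seteqP; split => w; last by case=> x _ [/= sw]; rewrite /T sw.
    by move=> TB; exists (sigma w).
  apply: fin_bigcup_measurable => // x _; apply: measurableI => //; exact: mA.
- move=> x B mB; rewrite TE.
  have mAB := mA x B mB.
  apply: EFin_inj; rewrite EFinM -!prE //; last exact: measurableI.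
  rewrite !uniform01E //; last exact: measurableI.
  rewrite -(@lebesgue_affine (a x)) //; last exact: measurableI.
  congr (leb _); rewrite setIAC -/unit_itv sigmaE.
  apply/seteqP; split => w /=.
    move=> [/JP /andP[h1 h2] h3]; split => //; rewrite /unit_itv /= in_itv /=.
    rewrite divr_ge0 ?subr_ge0 ?(ltW (p0 x)) //= ltr_pdivrMr //; lra.
  move=> [h3]; rewrite /unit_itv /= in_itv /= ltr_pdivrMr // ler_pdivlMr // mul0r => /andP[h1 h2].
  by split => //; apply/JP/andP; split; lra.
Qed.

End UnitInterval.

(** * Independent letters read along a Bernoulli shift *)

Section ShiftSystem.
Context {R : realType} dO {O : measurableType dO} (P : probability O R) {d : nat}.
Variables (sigma : O -> letter d) (T : O -> O) (p : letter d -> R).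
Hypothesis msigma : forall x, measurable (sigma @^-1` [set x]).
Hypothesis mT : measurable_fun setT T.
Hypothesis PT : forall x B, measurable B ->
  pr P (sigma @^-1` [set x] `&` T @^-1` B) = p x * pr P B.
Implicit Types (x y : letter d) (w : O) (l : seq (letter d)) (B : set O).

Lemma measurable_preT B : measurable B -> measurable (T @^-1` B).
Proof. by move=> mB; rewrite -[X in measurable X]setTI; exact: mT. Qed.

Lemma measurable_iterT n B : measurable B -> measurable (iter n T @^-1` B).
Proof.
elim: n B => [|n IH] B mB //.
have -> : iter n.+1 T @^-1` B = T @^-1` (iter n T @^-1` B).
  by apply/seteqP; split => w /=; rewrite -iterSr.
by apply: measurable_preT; exact: IH.
Qed.

Lemma pr_by_letter B : measurable B ->
  pr P B = \sum_x pr P (sigma @^-1` [set x] `&` B).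
Proof.
move=> mB; rewrite -pr_bigsum.
- by congr pr; apply/seteqP; split => w /=; [exists (sigma w)|case=> x []].
- by move=> x; exact: measurableI.
- move=> x y xy; apply/seteqP; split => // w [[/= sx _] [/= sy _]].
  by move: xy; rewrite -sx -sy eqxx.
Qed.

Definition letters_upto n w : seq (letter d) := mkseq (fun i => sigma (iter i T w)) n.

Lemma letters_uptoS n w : letters_upto n.+1 w = sigma w :: letters_upto n (T w).
Proof.
rewrite /letters_upto /mkseq /= -[1%N]addn0 iotaDl -map_comp; congr (_ :: _).
by apply: eq_map => i /=; rewrite -iterSr.
Qed.

Lemma measurable_letters_upto n (Q : set (seq (letter d))) :
  measurable (letters_upto n @^-1` Q).
Proof.
elim: n Q => [|n IH] Q.
  have [Q0|Q0] := pselect (Q [::]).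
    by rewrite (_ : _ @^-1` _ = setT) //; apply/seteqP; split.
  by rewrite (_ : _ @^-1` _ = set0) //; apply/seteqP; split.
have -> : letters_upto n.+1 @^-1` Q = \bigcup_(x in [set: letter d])
   (sigma @^-1` [set x] `&` T @^-1` (letters_upto n @^-1` [set l | Q (x :: l)])).
  apply/seteqP; split => w /=; rewrite letters_uptoS.
    by move=> Qw; exists (sigma w).
  by case=> x _ [/= ->].
apply: fin_bigcup_measurable => // x _; apply: measurableI => //.
by apply: measurable_preT; exact: IH.
Qed.

(** Markov property: the first n letters are independent of the path shifted by n, whose law is
    again [P]. Hypothesis [PT] is the one-letter form, and the induction splits on the first
    letter. *)
Lemma pr_letters_upto n (Q : set (seq (letter d))) B : measurable B ->
  pr P (letters_upto n @^-1` Q `&` iter n T @^-1` B) =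
  pr P (letters_upto n @^-1` Q) * pr P B.
Proof.
move=> mB; elim: n Q => [|n IH] Q.
  have [Q0|Q0] := pselect (Q [::]).
    rewrite (_ : _ @^-1` Q = setT) ?setTI ?prT ?mul1r //.
    by apply/seteqP; split.
  rewrite (_ : _ @^-1` Q = set0); first by rewrite set0I /pr measure0 mul0r.
  by apply/seteqP; split.
pose Qx x := [set l | Q (x :: l)].
have mL m Q' := measurable_letters_upto m Q'.
rewrite pr_by_letter; last by apply: measurableI => //; exact: measurable_iterT.
rewrite [in RHS]pr_by_letter // mulr_suml; apply: eq_bigr => x _.
have -> : sigma @^-1` [set x] `&` (letters_upto n.+1 @^-1` Q `&` iter n.+1 T @^-1` B) =
    sigma @^-1` [set x] `&` T @^-1` (letters_upto n @^-1` Qx x `&` iter n T @^-1` B).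
  by apply/seteqP; split => w /= [sx]; rewrite letters_uptoS sx /Qx -iterSr.
have -> : sigma @^-1` [set x] `&` letters_upto n.+1 @^-1` Q =
    sigma @^-1` [set x] `&` T @^-1` (letters_upto n @^-1` Qx x).
  by apply/seteqP; split => w /= [sx]; rewrite letters_uptoS sx.
rewrite !PT //; last by apply: measurableI => //; exact: measurable_iterT.
by rewrite IH mulrA.
Qed.

Lemma pr_letter x : pr P (sigma @^-1` [set x]) = p x.
Proof. by have := PT x measurableT; rewrite setIT prT mulr1. Qed.

Lemma pr_iterT n B : measurable B -> pr P (iter n T @^-1` B) = pr P B.
Proof.
by move=> mB; have := pr_letters_upto n setT mB; rewrite setTI prT mul1r.
Qed.

Definition step (i : nat) w : free_group d := fg_letter (sigma (iter i T w)).

Lemma step_measurable i : measurable_fun setT (step i).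
Proof.
move=> _ A _; rewrite setTI.
have -> : step i @^-1` A = \bigcup_(x in [set x | A (fg_letter x)])
   iter i T @^-1` (sigma @^-1` [set x]).
  apply/seteqP; split => w /=; first by move=> Aw; exists (sigma (iter i T w)).
  by case=> x Ax /= sx; rewrite /step sx.
by apply: fin_bigcup_measurable => // x _; exact: measurable_iterT.
Qed.

HB.instance Definition _ i := isMeasurableFun.Build _ _ _ _ (step i) (step_measurable i).

Lemma stepS i w : step i.+1 w = step i (T w).
Proof. by rewrite /step iterSr. Qed.

Definition step_law : probability (free_group d) R := distribution P (step 0).

Lemma measurable_step i A : measurable (step i @^-1` A).
Proof. by have := @step_measurable i measurableT A; rewrite setTI; exact. Qed.

Lemma distribution_step i A : distribution P (step i) A = step_law A.
Proof.
have m0 := measurable_step 0 A.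
have -> : distribution P (step i) A = P (iter i T @^-1` (step 0 @^-1` A)) by [].
by rewrite (prE P (measurable_iterT _ m0)) pr_iterT // -prE.
Qed.

Lemma step_law_letter x : pr step_law [set fg_letter x] = p x.
Proof.
rewrite -(pr_letter x); congr (fine (P _)); apply/seteqP; split => w /=.
  exact: fg_letter_inj.
by rewrite /step /= => ->.
Qed.

Lemma step_lawE A : pr step_law A = \sum_x (if `[< A (fg_letter x) >] then p x else 0).
Proof.
rewrite -[LHS]/(pr P (step 0 @^-1` A)) (pr_by_letter (measurable_step 0 A)).
apply: eq_bigr => x _; case: asboolP => Ax.
  rewrite -pr_letter; congr pr; apply/seteqP; split => w /=; first by case.
  by move=> sx; rewrite /step /= sx.
rewrite (_ : _ `&` _ = set0) ?/pr ?measure0 //.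
by apply/seteqP; split => w //= -[sx]; rewrite /step /= sx.
Qed.

Lemma step_law_supported : supported_on_generators step_law.
Proof.
move=> g; rewrite /msupport /= (prE step_law) // lte_fin step_lawE => g0.
have [x Ex] : exists x, g = fg_letter x.
  apply: contrapT => /forallNP h; move: g0; rewrite big1 ?ltxx // => x _.
  by case: asboolP => //= /esym /h.
by exists x.1; rewrite Ex generatorE fg_letterV; case: (x) => i [] /=; [right|left].
Qed.

Lemma step_law_symmetric : (forall x, p (inv_letter x) = p x) ->
  symmetric_measure step_law.
Proof.
move=> pV A; rewrite !(prE step_law) // !step_lawE; congr EFin.
rewrite -(reindex_inv_letter (fun x => if `[< A (fg_letter x) >] then p x else 0)).
by apply: eq_bigr => x _; rewrite /= fg_letterV pV.
Qed.

Lemma step_law_generating : (forall x, 0 < p x) -> generating_measure step_law.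
Proof.
move=> p0 H HH HS.
have Hx x : fg_letter x \in H.
  by apply: HS; rewrite /msupport /= (prE step_law) // step_law_letter lte_fin.
case=> l rl; elim: l rl => [|x l IH] rl.
  by rewrite (_ : FreeGroup rl = 1%g) ?HH.1 //; apply: val_inj.
have rl' : reduced l by move: rl; rewrite /reduced /=; exact: path_sorted.
have -> : FreeGroup rl = (fg_letter x * FreeGroup rl')%g.
  apply: val_inj => /=; move: rl; rewrite /reduced /=; case: l {IH rl'} => //= y l.
  by move=> /andP[/negbTE ->].
by apply: (group_closedM HH) => //; exact: IH.
Qed.

Let pr_prefix N (A : nat -> set (free_group d)) :
  pr P [set w | forall i, (i < N)%N -> A i (step i w)] =
  \prod_(i < N) pr step_law (A i).
Proof.
elim: N A => [|N IH] A.
  by rewrite big_ord0 (_ : [set _ | _] = setT) ?prT //; apply/seteqP; split.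
have mN (C : nat -> set (free_group d)) :
    measurable [set w | forall i, (i < N)%N -> C i (step i w)].
  have -> : [set w | forall i, (i < N)%N -> C i (step i w)] =
      \bigcap_(i in [set i | (i < N)%N]) step i @^-1` C i by [].
  by apply: bigcap_measurableType => i _; exact: measurable_step.
have -> : [set w | forall i, (i < N.+1)%N -> A i (step i w)] =
    step 0 @^-1` A 0%N `&` T @^-1` [set w | forall i, (i < N)%N -> A i.+1 (step i w)].
  apply/seteqP; split => w /=.
    by move=> H; split; [exact: H|move=> i iN; rewrite -stepS; exact: H].
  by move=> [H0 H] [|i] iN //; rewrite stepS; exact: H.
pose B := [set w | forall i, (i < N)%N -> A i.+1 (step i w)].
have mB : measurable B by exact: (mN (fun i => A i.+1)).
rewrite -/B.
rewrite big_ord_recl -(IH (fun i => A i.+1)) -/B pr_by_letter; last first.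
  exact: (measurableI _ _ (measurable_step 0 (A 0%N)) (measurable_preT mB)).
have -> : pr step_law (A ord0) = pr P (step 0 @^-1` A 0%N) by [].
rewrite (pr_by_letter (measurable_step 0 (A 0%N))) mulr_suml; apply: eq_bigr => x _.
have [Ax|Ax] := pselect (A 0%N (fg_letter x)).
  rewrite (_ : _ `&` _ = sigma @^-1` [set x] `&` T @^-1` B); last first.
    by apply/seteqP; split => w /= [sx]; [case|]; rewrite /step /= sx.
  rewrite (_ : _ `&` step 0 @^-1` _ = sigma @^-1` [set x]); last first.
    by apply/seteqP; split => w /=; [case|move=> sx; rewrite /step /= sx].
  by rewrite PT // pr_letter.
rewrite (_ : _ `&` _ = set0); last first.
  by apply/seteqP; split => w //= [sx []]; rewrite /step /= sx.
rewrite (_ : _ `&` step 0 @^-1` _ = set0); last first.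
  by apply/seteqP; split => w //= [sx]; rewrite /step /= sx.
by rewrite /pr measure0 mul0r.
Qed.

Lemma step_independent : independent_RVs (fun i => step i : {RV P >-> free_group d}).
Proof.
move=> I A uI _.
pose N := (\max_(i <- I) i).+1.
(* The index set is completed to an initial segment by sure events, so that [pr_prefix] applies. *)
pose A' i := if i \in I then A i else setT.
have IN i : i \in I -> (i < N)%N by move=> iI; rewrite ltnS; exact: leq_bigmax_seq.
have -> : \bigcap_(i in [set` I]) step i @^-1` A i =
    [set w | forall i, (i < N)%N -> A' i (step i w)].
  apply/seteqP; split => w /= H i.
    by move=> _; rewrite /A'; case: ifPn => // iI; exact: H.
  by move=> /= iI; have := H i (IN _ iI); rewrite /A' iI.
have mH : measurable [set w | forall i, (i < N)%N -> A' i (step i w)].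
  have -> : [set w | forall i, (i < N)%N -> A' i (step i w)] =
      \bigcap_(i in [set i | (i < N)%N]) step i @^-1` A' i by [].
  by apply: bigcap_measurableType => i _; exact: measurable_step.
rewrite (prE _ mH) pr_prefix.
rewrite (eq_bigr (fun i => (pr step_law (A i))%:E)); last first.
  move=> i _; rewrite -(prE step_law) //.
  exact: (distribution_step i (A i)).
rewrite prodEFin; congr EFin.
rewrite -(big_mkord xpredT (fun i => pr step_law (A' i))).
rewrite (bigID (fun i => i \in I)) /= [X in _ * X]big1 ?mulr1; last first.
  by move=> i /negbTE iI; rewrite /A' iI prT.
rewrite -big_filter; apply/esym; rewrite (eq_big_seq (fun i => pr step_law (A' i))).
  apply: perm_big; apply: uniq_perm => //; first by rewrite filter_uniq // iota_uniq.
  move=> i; rewrite mem_filter mem_index_iota /=.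
  by case: (boolP (i \in I)) => //= /IN.
by move=> i iI; rewrite /A' iI.
Qed.

End ShiftSystem.

(** * Deterministic paths in the Cayley tree *)

Section Paths.
Context {d : nat}.
Implicit Types (x y : letter d) (g : free_group d) (xi eta : boundary d).

(** The product is defined by pushing letters on the left; inversion, which reverses words, carries
    this to the right end. *)
Lemma word_mul_letter g x :
  word (g * fg_letter x)%g = rcons (word g) x \/
  exists w, word g = rcons w (inv_letter x) /\ word (g * fg_letter x)%g = w.
Proof.
pose vinv (w : seq (letter d)) := rev (map (@inv_letter d) w).
have vinvK : involutive vinv.
  move=> w; rewrite /vinv map_rev revK -map_comp (eq_map (@inv_letterK d)).
  exact: map_id.
have -> : word (g * fg_letter x)%g = vinv (push (inv_letter x) (vinv (word g))).
  rewrite -{1}[(g * _)%g]invgK invgM fg_letterV.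
  by rewrite -[RHS]/(word ((fg_letter (inv_letter x) * g^-1)^-1)%g).
case/lastP: (word g) => [|w y]; first by left; rewrite /vinv /= /vinv /= inv_letterK.
have -> : vinv (rcons w y) = inv_letter y :: vinv w by rewrite /vinv map_rcons rev_rcons.
rewrite /=; case: ifPn => [/eqP E|_].
  right; exists w; split; last exact: vinvK.
  by rewrite inv_letterK in E; rewrite -[y]inv_letterK E.
left; have -> : vinv [:: inv_letter x, inv_letter y & vinv w] = rcons (rcons (vinv (vinv w)) y) x.
  by rewrite {1}/vinv /= !rev_cons !inv_letterK.
by rewrite vinvK.
Qed.

Lemma take_word_mul_letter g x k : (k < size (word g))%N ->
  take k (word (g * fg_letter x)%g) = take k (word g).
Proof.
have [-> |[w [-> ->]]] := word_mul_letter g x => h.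
  by rewrite -cats1 takel_cat // ltnW.
by rewrite size_rcons ltnS in h; rewrite -cats1 takel_cat.
Qed.

Definition nearest_neighbour (r : nat -> free_group d) :=
  r 0%N = 1%g /\ forall n, exists x, r n.+1 = (r n * fg_letter x)%g.

(** The Cayley graph is a tree. When the word starts with x for the first time, the step cannot have
    deleted a letter, so it appended one to a word not starting with x, which must be empty. *)
Lemma nearest_neighbour_hit r x m : nearest_neighbour r -> starts x (r m) ->
  exists n, r n = fg_letter x.
Proof.
move=> [r0 rS] xm.
have ex : exists m, ohead (word (r m)) == Some x by exists m; apply/eqP.
case: (ex_minnP ex) => -[|n] /eqP sn nmin; first by move: sn; rewrite r0.
exists n.+1; have [y E] := rS n.
have nn : ohead (word (r n)) <> Some x.
  by move=> /eqP /nmin; rewrite ltnn.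
apply: val_inj => /=; move: sn; rewrite E.
have [-> |[w [Ew ->]]] := word_mul_letter (r n) y.
  by case: (word (r n)) nn => [|z w] //= _ [->].
by move: nn; rewrite Ew; case: w {Ew} => [|z w] //= nn [zx]; case: nn; rewrite zx.
Qed.

Lemma cvg_to_boundary_unique r xi eta :
  cvg_to_boundary r xi -> cvg_to_boundary r eta -> xi = eta.
Proof.
move=> h1 h2; apply: boundary_inj => n.
have [N _ H] := filterI (h1 n.+1) (h2 n.+1).
have : nth (bletter xi n) (mkseq (bletter xi) n.+1) n =
       nth (bletter xi n) (mkseq (bletter eta) n.+1) n.
  by have [E1 E2] := H N (leqnn N); rewrite -E1 -E2.
by rewrite !nth_mkseq.
Qed.

Lemma mkseq_cons T (f : nat -> T) k : mkseq f k.+1 = f 0%N :: mkseq (fun i => f i.+1) k.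
Proof. by rewrite /mkseq /= -[1%N]addn0 iotaDl -map_comp. Qed.

Lemma take_mkseq T (f : nat -> T) j k : (j <= k)%N -> take j (mkseq f k) = mkseq f j.
Proof. by move=> jk; rewrite /mkseq -map_take take_iota (minn_idPl jk). Qed.

(** A prefix of length k + 1 of the original path is needed, since a cancellation costs one
    letter. *)
Lemma cvg_to_boundary_act r xi x : cvg_to_boundary r xi ->
  cvg_to_boundary (fun n => (fg_letter x * r n)%g) (boundary_act (fg_letter x) xi).
Proof.
move=> h k; apply: filterS (h k.+1) => n; rewrite word_letter_mul mkseq_cons.
case: (word (r n)) => [|y w] //= [-> Ek].
have take_w j : (j <= k)%N -> take j w = mkseq (fun i => bletter xi i.+1) j.
  move=> jk; have := congr1 (take j) Ek.
  by rewrite -take_min (minn_idPl jk) take_mkseq.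
have -> : mkseq (bletter (boundary_act (fg_letter x) xi)) k = mkseq (bpush_seq x xi) k.
  by [].
case: ifPn => E0; rewrite /bpush_seq.
  by rewrite take_w //; apply: eq_map => i; rewrite E0.
rewrite (negbTE E0); case: k take_w {Ek} => [|[|k]] take_w //.
by rewrite !mkseq_cons /= take_w // ltnW.
Qed.

Lemma cvg_to_boundary_starts r xi : cvg_to_boundary r xi ->
  \forall n \near \oo, starts (bletter xi 0) (r n).
Proof.
move=> h; apply: filterS (h 1%N) => n; rewrite /starts /=.
by case: (word (r n)) => [|y w] //= [->].
Qed.

Lemma cvg_to_boundary_leaves r xi g : cvg_to_boundary r xi ->
  \forall n \near \oo, r n != g.
Proof.
move=> h; apply: filterS (h (size (word g)).+1) => n E.
apply/eqP => rg; have := congr1 size E.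
by rewrite rg take_oversize // size_mkseq => /n_Sn.
Qed.

Lemma nearest_neighbour_cvg r : nearest_neighbour r ->
  (forall g, \forall n \near \oo, r n != g) -> exists xi, cvg_to_boundary r xi.
Proof.
move=> [r0 rS] leaves.
have long k : \forall n \near \oo, (k < size (word (r n)))%N.
  have : \forall n \near \oo, forall b : {bseq k of letter d}, word (r n) != b.
    apply: filter_forall => b.
    have [rb|nrb] := boolP (reduced b); last first.
      by near=> n; apply: contraNneq nrb => <-; exact: word_reduced.
    apply: filterS (leaves (FreeGroup rb)) => n; apply: contra => /eqP E.
    by apply/eqP; exact: val_inj.
  apply: filterS => n H; rewrite ltnNge; apply/negP => le.
  by have := H (Bseq le); rewrite eqxx.
have stable k : exists N, forall n, (N <= n)%N ->
    (k < size (word (r n)))%N /\ take k (word (r n)) = take k (word (r N)).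
  have [N _ H] := long k; exists N => n Nn; split; first exact: H.
  elim: n Nn => [|n IH]; first by rewrite leqn0 => /eqP ->.
  rewrite leq_eqVlt => /orP[/eqP -> //|]; rewrite ltnS => Nn.
  have [x ->] := rS n; rewrite take_word_mul_letter ?IH //; exact: H.
have [N HN] := choice stable.
pose v k := take k (word (r (N k))).
have vE k n : (N k <= n)%N -> take k (word (r n)) = v k by move=> /HN[].
have sv k : size (v k) = k.
  by rewrite size_takel // ltnW //; have [] := HN k (N k) (leqnn _).
have v_take j k : (j <= k)%N -> v j = take j (v k).
  move=> jk; rewrite -(vE j (maxn (N j) (N k))) ?leq_maxl //.
  by rewrite -(vE k (maxn (N j) (N k))) ?leq_maxr // -take_min (minn_idPl jk).
(* A default letter for [nth]; in rank 0 there is none, so it is read off a prefix of length 1. *)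
have x0 : letter d by have := sv 1%N; case: (v 1%N).
pose xi0 n := nth x0 (v n.+1) n.
have xi0E n k : (n < k)%N -> xi0 n = nth x0 (v k) n.
  by move=> nk; rewrite /xi0 (v_take _ _ nk) nth_take.
have xi0P : xi0 \in reduced_seq d.
  apply/mem_set => n; rewrite (xi0E n n.+2) // (xi0E n.+1 n.+2) //.
  have : reduced (v n.+2) by apply: take_sorted; exact: word_reduced.
  rewrite /reduced => /(sortedP x0)/(_ n); rewrite sv; exact.
exists (SigSub xi0P) => k; exists (N k) => // n Nn /=.
rewrite (vE k) //; apply: (@eq_from_nth _ x0); first by rewrite sv size_mkseq.
by move=> i; rewrite sv => ik; rewrite nth_mkseq // /bletter /= (xi0E i k).
Unshelve. all: by end_near. Qed.

End Paths.

(** * Cylinders and the Borel structure of the boundary *)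

Section BoundaryBorel.
Context {d : nat}.
Implicit Types (x : letter d) (xi eta : boundary d).

Definition bstarts x : set (boundary d) := [set xi | bletter xi 0 = x].

Lemma bstarts_act x xi :
  bstarts x (boundary_act (fg_letter x) xi) <-> ~ bstarts (inv_letter x) xi.
Proof.
rewrite /bstarts /boundary_act /= {1}/bletter /= /bpush_seq.
case: eqP => E; last by split.
split; last by move=> /(_ E).
have := bletterP xi 0; rewrite E inv_letterK => /eqP h h'.
by case: h.
Qed.

Lemma bstarts_inj x y xi : bstarts x xi -> bstarts y xi -> x = y.
Proof. by rewrite /bstarts /= => <- <-. Qed.

Lemma boundary_act_letterK x :
  cancel (boundary_act (fg_letter x)) (boundary_act (fg_letter (inv_letter x))).
Proof. by move=> xi; rewrite -boundary_actM -fg_letterV mulVg boundary_act1. Qed.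

(** Otherwise points outside A sharing ever longer prefixes with xi would converge to xi
    coordinatewise, contradicting openness. *)
Lemma open_cylinder (A : set (boundary d)) xi : open A -> A xi ->
  exists k, forall eta, mkseq (bletter eta) k = mkseq (bletter xi) k -> A eta.
Proof.
move=> oA Axi; apply: contrapT => /forallNP h.
have {}h k : exists eta, mkseq (bletter eta) k = mkseq (bletter xi) k /\ ~ A eta.
  by have /existsNP[eta /not_implyP[]] := h k; exists eta.
have [eta etaP] := choice h.
have : nbhs xi A by apply: open_nbhs_nbhs; split.
move=> [_ [[B oB <-] /= Bxi BA]].
pose S := prod_topology (fun _ : nat => discrete_topology (letter d)).
have H : ((fun k => val (eta k)) : nat -> S) @ \oo --> (val xi : S).
  apply/cvg_sup => n U [_ [[V oV <-] /= Vx VU]].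
  exists n.+1 => // k /= nk; apply: VU => /=.
  have [E _] := etaP k.
  have : nth (bletter xi n) (mkseq (bletter (eta k)) k) n =
         nth (bletter xi n) (mkseq (bletter xi) k) n by rewrite E.
  by rewrite !nth_mkseq // /bletter => ->.
have HB : nbhs (val xi : S) B by apply: open_nbhs_nbhs; split.
have [N _ HN] := H B HB.
have [_ []] := etaP N; apply: BA; exact: (HN N (leqnn N)).
Qed.

Lemma open_bstarts x : open (bstarts x).
Proof.
rewrite openE => xi xix; apply: filterS (near_bletter xi 0) => eta.
by rewrite /bstarts /= => ->.
Qed.

End BoundaryBorel.

Lemma measurable_bstarts d (x : letter d.+1) : measurable (bstarts x).
Proof. by apply: sub_sigma_algebra; exact: open_bstarts. Qed.

(** Finite words are countable, so an open set is a countable union of the cylinders that it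
    contains. *)
Lemma measurable_boundary_fun d dO (O : measurableType dO) (f : O -> boundary d.+1) :
  (forall l : seq (letter d.+1), measurable [set w | mkseq (bletter (f w)) (size l) = l]) ->
  measurable_fun setT f.
Proof.
move=> mf; apply: (@measurability _ _ _ _ _ _ (@open (boundary d.+1))) => //.
move=> _ [A oA <-]; rewrite setTI.
pose cyl (l : seq (letter d.+1)) : set (boundary d.+1) :=
  [set xi | mkseq (bletter xi) (size l) = l].
have -> : f @^-1` A = \bigcup_(l : seq (letter d.+1))
    (if pselect (cyl l `<=` A) then [set w | mkseq (bletter (f w)) (size l) = l] else set0).
  apply/seteqP; split => w /=; last first.
    by case=> l _; case: pselect => // lA /lA.
  move=> Afw; have [k kA] := open_cylinder oA Afw.
  exists (mkseq (bletter (f w)) k) => //; case: pselect => [_|[]] /=.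
    by rewrite size_mkseq.
  by move=> eta; rewrite /cyl /= size_mkseq => /kA.
apply: countable_bigcupT_measurable; first exact: countableP.
by move=> l; case: pselect => _ /=; [exact: mf|exact: measurable0].
Qed.

(** * Transience, the limit point and its law *)

Section RandomWalkLimit.
Context {R : realType} dO {O : measurableType dO} (P : probability O R) {d : nat}.
Variables (sigma : O -> letter d.+1) (T : O -> O) (p F : letter d.+1 -> R).
Hypothesis msigma : forall x, measurable (sigma @^-1` [set x]).
Hypothesis mT : measurable_fun setT T.
Hypothesis PT : forall x B, measurable B ->
  pr P (sigma @^-1` [set x] `&` T @^-1` B) = p x * pr P B.
Hypothesis p_ge0 : forall x, 0 <= p x.
Hypothesis F01 : forall x, 0 < F x < 1.
Hypothesis FV : forall x, F (inv_letter x) = F x.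
Let U := \sum_x p x * F x.
Hypothesis U_lt1 : U < 1.
Hypothesis pF : forall x, p x * (1 - F x ^+ 2) = (1 - U) * F x.
Implicit Types (x y : letter d.+1) (w : O) (B : set O) (g : free_group d.+1).

Local Notation steps w := (fun i => step sigma T i w).
Let rw n w : free_group d.+1 := walk (steps w) n.

Lemma walk0 w : rw 0 w = 1%g.
Proof. by rewrite /rw /walk big_ord0. Qed.

Lemma walkSr n w : rw n.+1 w = (rw n w * fg_letter (sigma (iter n T w)))%g.
Proof. by rewrite /rw /walk big_ord_recr. Qed.

Lemma walkSl n w : rw n.+1 w = (fg_letter (sigma w) * rw n (T w))%g.
Proof.
rewrite /rw /walk big_ord_recl; congr (_ * _)%g.
by apply: eq_bigr => i _; rewrite /= stepS.
Qed.

Lemma walk_nearest_neighbour w : nearest_neighbour (fun n => rw n w).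
Proof. by split; [exact: walk0|move=> n; eexists; exact: walkSr]. Qed.

Let lprod (l : seq (letter d.+1)) : free_group d.+1 := (\prod_(x <- l) fg_letter x)%g.

Let walk_lprod n w : rw n w = lprod (letters_upto sigma T n w).
Proof.
rewrite /rw /walk /lprod /letters_upto /mkseq big_map.
by rewrite -(big_mkord xpredT (fun i => step sigma T i w)) /index_iota subn0.
Qed.

Lemma measurable_walk n (A : set (free_group d.+1)) : measurable (rw n @^-1` A).
Proof.
rewrite (_ : _ @^-1` _ = letters_upto sigma T n @^-1` [set l | A (lprod l)]).
  exact: measurable_letters_upto.
by apply/seteqP; split => w /=; rewrite walk_lprod.
Qed.

Let visit n g : R := pr P (rw n @^-1` [set g]).

Let visitS n g : visit n.+1 g = \sum_y p y * visit n (fg_letter (inv_letter y) * g)%g.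
Proof.
rewrite /visit (@pr_by_letter _ _ _ P _ _ msigma) //; last exact: measurable_walk.
apply: eq_bigr => y _; rewrite -PT; last exact: measurable_walk.
congr pr; apply/seteqP; split => w /= [sy]; rewrite walkSl sy => E; split => //.
  by rewrite -E letter_mulK.
by rewrite E letter_mulVK.
Qed.

Let F_gt0 x : 0 < F x. Proof. by have /andP[] := F01 x. Qed.

(** If g starts with x, only y = x shortens it, dividing the weight by F x; every other y multiplies
    it by F y. Hypothesis [pF] says exactly that the mean is then unchanged. At the identity the
    mean is U instead of 1. *)
Let superharmonic g : \sum_y p y * word_weight F (fg_letter (inv_letter y) * g)%g =
  word_weight F g - (1 - U) * (g == 1%g)%:R.
Proof.
have [->|[x xg]] := word_cases g.
  rewrite eqxx mulr1 /word_weight big_nil opprB addrCA subrr addr0.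
  by apply: eq_bigr => y _; rewrite big_seq1 FV.
have -> : (g == 1%g) = false by apply/eqP => g1; move: xg; rewrite g1.
rewrite mulr0 subr0 (bigD1 x) //=.
rewrite (eq_bigr (fun y => p y * F y * word_weight F g)); last first.
  move=> y yx; rewrite word_weight_mul // ?FV ?mulrA // inv_letterK => yg.
  by move: yx; rewrite (starts_inj xg yg) eqxx.
rewrite -mulr_suml.
have -> : \sum_(y | y != x) p y * F y = U - p x * F x.
  by rewrite /U [in RHS](bigD1 x) //= addrAC subrr add0r.
have -> : word_weight F g = F x * word_weight F (fg_letter (inv_letter x) * g)%g.
  rewrite -word_weight_mul ?letter_mulVK //.
  by rewrite starts_mul inv_letterK; apply.
have := pF x; set u := word_weight _ _ => h.
have -> : p x * u + (U - p x * F x) * (F x * u) =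
  u * (p x * (1 - F x ^+ 2) + U * F x) by ring.
by rewrite h; ring.
Qed.

(* word_weight F is superharmonic with defect 1 - U at the identity only, hence it
   dominates 1 - U times the Green function. *)
Let green N g : \sum_(n < N) visit n g <= word_weight F g / (1 - U).
Proof.
have U1 : 0 < 1 - U by rewrite subr_gt0.
elim: N g => [|N IH] g.
  by rewrite big_ord0 divr_ge0 ?ltW // word_weight_gt0.
rewrite big_ord_recl /= (eq_bigr (fun i : 'I_N =>
    \sum_y p y * visit i (fg_letter (inv_letter y) * g)%g)); last by move=> i _; exact: visitS.
rewrite exchange_big /=.
apply: (@le_trans _ _ ((g == 1%g)%:R +
   \sum_y p y * (word_weight F (fg_letter (inv_letter y) * g)%g / (1 - U)))).
  apply: lerD.
    rewrite /visit; case: eqP => [_|g1]; first by apply: pr_le1; exact: measurable_walk.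
    rewrite (_ : _ @^-1` _ = set0) ?/pr ?measure0 //.
    by apply/seteqP; split => // w /=; rewrite walk0 => /esym.
  by apply: ler_sum => y _; rewrite -mulr_sumr ler_wpM2l.
under eq_bigr do rewrite mulrA.
rewrite -mulr_suml superharmonic mulrBl mulrAC divff ?gt_eqF // mul1r.
lra.
Qed.

Definition leaves : set O := [set w | forall g, \forall n \near \oo, rw n w != g].

Let returns g : set O := lim_sup_set (fun n => rw n @^-1` [set g]).

Let leavesC : ~` leaves = \bigcup_g returns g.
Proof.
apply/seteqP; split => w.
  move=> /existsNP[g nl]; exists g => // N _; apply: contrapT => h; apply: nl.
  exists N => // n /= Nn; apply/eqP => E; apply: h; by exists n.
move=> [g _ h] l; have [N _ H] := l g.
have [n /= Nn E] := h N I.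
by have := H n Nn; rewrite /= E eqxx.
Qed.

Let measurable_returns g : measurable (returns g).
Proof.
apply: bigcap_measurableType => // n _; apply: bigcup_measurable => k _.
exact: measurable_walk.
Qed.

Lemma measurable_leaves : measurable leaves.
Proof.
rewrite -[leaves]setCK leavesC; apply: measurableC.
by apply: countable_bigcupT_measurable => //; exact: countableP.
Qed.

(** Borel-Cantelli: [green] bounds the sum of the visit probabilities. *)
Let returns0 g : P (returns g) = 0%E.
Proof.
apply: lim_sup_set_cvg0 => [n|]; first exact: measurable_walk.
apply: (@le_lt_trans _ _ (word_weight F g / (1 - U))%:E); last exact: ltry.
apply: lime_le; first exact: is_cvg_nneseries.
apply: nearW => N; rewrite big_mkord (eq_bigr (fun n : 'I_N => (visit n g)%:E)).
  by rewrite sumEFin lee_fin green.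
by move=> n _; rewrite -prE //; exact: measurable_walk.
Qed.

Lemma leaves_ae : pr P (~` leaves) = 0.
Proof.
rewrite /pr (_ : P _ = 0%E) //.
have N : P.-negligible (~` leaves).
  rewrite leavesC.
  have -> : \bigcup_g returns g =
      \bigcup_n (if unpickle n is Some g then returns g else set0).
    apply/seteqP; split => w.
      by case=> g _ rg; exists (pickle g) => //; rewrite pickleK.
    by case=> n _; case: unpickle => [g|] // rg; exists g.
  apply: negligible_bigcup => n; case: unpickle => [g|]; last exact: negligible_set0.
  by exists (returns g); split => //; exact: returns0.
by apply/negligibleP => //; apply: measurableC; exact: measurable_leaves.
Qed.

Lemma pr_leaves_eq (A B : set O) : measurable A -> measurable B ->
  (forall w, leaves w -> A w <-> B w) -> pr P A = pr P B.
Proof.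
move=> mA mB AB; have mL := measurable_leaves.
have E C : measurable C -> pr P C = pr P (C `&` leaves).
  move=> mC; have mC' := measurableI _ _ mC (measurableC mL).
  rewrite -{1}(setUIDK C leaves) prU //.
  - suff -> : pr P (C `\` leaves) = 0 by rewrite addr0.
    apply/eqP; rewrite eq_le pr_ge0 andbT -leaves_ae.
    by apply: le_pr => //; exact: measurableC.
  - exact: measurableI.
  - by apply/seteqP; split => w // -[[_ ?] []].
rewrite (E A) // (E B) //; congr pr.
by apply/seteqP; split => w [Aw lw]; split => //; apply/AB.
Qed.

Lemma leavesT w : leaves w -> leaves (T w).
Proof.
move=> lw g; have [N _ H] := lw (fg_letter (sigma w) * g)%g.
exists N => // n /= Nn; have := H n.+1 (leqW Nn).
by rewrite /= walkSl; apply: contra => /eqP ->.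
Qed.

Definition walk_limit w : boundary d.+1 :=
  xget point [set xi | cvg_to_boundary (fun n => rw n w) xi].

Lemma walk_limitP w : leaves w -> cvg_to_boundary (fun n => rw n w) (walk_limit w).
Proof.
move=> lw; have [xi xiP] := nearest_neighbour_cvg (walk_nearest_neighbour w) lw.
by rewrite /walk_limit; case: xgetP => [eta -> //|/(_ xi)].
Qed.

Lemma walk_limitN w : ~ leaves w -> walk_limit w = point.
Proof.
move=> nl; rewrite /walk_limit; case: xgetP => // xi _ /= cx; case: nl => g.
exact: cvg_to_boundary_leaves cx.
Qed.

(** Removing the first step translates the limit; this is the source of stationarity and of the
    decomposition at a passage time. *)
Lemma walk_limit_shift w : leaves w ->
  walk_limit w = boundary_act (fg_letter (sigma w)) (walk_limit (T w)).
Proof.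
move=> lw; apply: (cvg_to_boundary_unique (walk_limitP lw)) => k.
have [N _ H] := cvg_to_boundary_act (sigma w) (walk_limitP (leavesT lw)) k.
exists N.+1 => // -[//|n] /= Nn.
by rewrite walkSl; exact: H.
Qed.

Lemma walk_limit_iter n w : leaves w ->
  walk_limit w = boundary_act (rw n w) (walk_limit (iter n T w)) /\ leaves (iter n T w).
Proof.
move=> lw; elim: n => [|n [E ln]]; first by rewrite walk0.
split; last by rewrite iterS; exact: leavesT.
by rewrite E (walk_limit_shift ln) -boundary_actM -walkSr.
Qed.

Lemma walk_limit_measurable : measurable_fun setT walk_limit.
Proof.
apply: measurable_boundary_fun => l; have mL := measurable_leaves.
pose ev : set O := \bigcup_N \bigcap_(n in [set n | (N <= n)%N])
  rw n @^-1` [set g | take (size l) (word g) = l].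
have mev : measurable ev.
  apply: bigcup_measurable => N _; apply: bigcap_measurableType => n _.
  exact: measurable_walk.
(* Off [leaves] the limit is the constant [point], so the prefix condition there holds everywhere or
   nowhere. *)
pose dflt : set O := if mkseq (bletter (point : boundary d.+1)) (size l) == l then setT else set0.
have mdflt : measurable dflt.
  by rewrite /dflt; case: ifP => _; [exact: measurableT|exact: measurable0].
have -> : [set w | mkseq (bletter (walk_limit w)) (size l) = l] =
    (leaves `&` ev) `|` (~` leaves `&` dflt).
  apply/seteqP; split => w /=.
    move=> E; have [lw|lw] := pselect (leaves w); [left|right]; split => //.
      have [N _ H] := walk_limitP lw (size l); exists N => // n Nn /=.
      by rewrite (H n Nn) E.
    by rewrite /dflt -(walk_limitN lw) E eqxx.
  case=> -[lw]; last first.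
    by rewrite /dflt -(walk_limitN lw); case: ifP => // /eqP.
  move=> [N _ H]; have [M _ H'] := walk_limitP lw (size l).
  have <- := H' (maxn N M) (leq_maxr _ _).
  exact: (H (maxn N M) (leq_maxl _ _)).
apply: measurableU; apply: measurableI => //; exact: measurableC.
Qed.

HB.instance Definition _ := isMeasurableFun.Build _ _ _ _
  walk_limit walk_limit_measurable.

Definition limit_law : probability (boundary d.+1) R := distribution P walk_limit.

Let measurable_limit (B : set (boundary d.+1)) : measurable B -> measurable (walk_limit @^-1` B).
Proof. by move=> mB; rewrite -[X in measurable X]setTI; exact: walk_limit_measurable. Qed.

Let measurable_act g (B : set (boundary d.+1)) : measurable B -> measurable (@boundary_act d.+1 g @^-1` B).
Proof. by move=> mB; rewrite -[X in measurable X]setTI; exact: boundary_act_measurable. Qed.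

Lemma limit_law_stationary (B : set (boundary d.+1)) : measurable B ->
  pr limit_law B = \sum_y p y * pr limit_law (boundary_act (fg_letter y) @^-1` B).
Proof.
move=> mB; have mX := measurable_limit mB.
have -> : pr limit_law B = pr P (walk_limit @^-1` B) by [].
rewrite (pr_by_letter P msigma mX); apply: eq_bigr => y _.
have mY := measurable_limit (measurable_act (fg_letter y) mB).
rewrite -[X in _ * X]/(pr P (walk_limit @^-1` (boundary_act (fg_letter y) @^-1` B))).
rewrite -PT //; apply: pr_leaves_eq.
- exact: measurableI.
- by apply: measurableI => //; exact: measurable_preT.
- by move=> w lw /=; rewrite (walk_limit_shift lw); split=> -[sy]; rewrite sy.
Qed.

Let first_hit x n : set O := [set w | rw n w = fg_letter x /\
  forall k, (k < n)%N -> rw k w <> fg_letter x].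

(** The first passage is a stopping time: the event depends on the first n letters only, as
    [pr_letters_upto] requires. *)
Let first_hitE x n : exists Q, first_hit x n = letters_upto sigma T n @^-1` Q.
Proof.
exists [set l | lprod l = fg_letter x /\
  forall k, (k < n)%N -> lprod (take k l) <> fg_letter x].
have tk k w : (k < n)%N -> lprod (take k (letters_upto sigma T n w)) = rw k w.
  by move=> kn; rewrite walk_lprod /letters_upto take_mkseq // ltnW.
apply/seteqP; split => w /= [E H]; split.
- by rewrite -walk_lprod.
- by move=> k kn; rewrite tk //; exact: H.
- by rewrite walk_lprod.
- by move=> k kn; rewrite -tk //; exact: H.
Qed.

Let measurable_first_hit x n : measurable (first_hit x n).
Proof. by have [Q ->] := first_hitE x n; exact: measurable_letters_upto. Qed.

Let first_hit_exists x w m : rw m w = fg_letter x -> exists n, first_hit x n w.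
Proof.
move=> E; have ex : exists m, rw m w == fg_letter x by exists m; apply/eqP.
case: (ex_minnP ex) => n /eqP En nmin; exists n; split => // k kn Ek.
by have := nmin k; rewrite Ek eqxx => /(_ isT); rewrite leqNgt kn.
Qed.

Let first_hit_inj x w i j : first_hit x i w -> first_hit x j w -> i = j.
Proof.
move=> [Ei Hi] [Ej Hj].
have [ij|ji|//] := ltngtP i j; first by case: (Hj i ij).
by case: (Hi j ji).
Qed.

Definition hit_prob x : R := pr P (\bigcup_n first_hit x n).

Let mhit x : measurable (\bigcup_n first_hit x n).
Proof. exact: bigcup_measurable. Qed.

Lemma hit_prob_le1 x : hit_prob x <= 1.
Proof. exact: pr_le1. Qed.

Lemma hit_prob_ge0 x : 0 <= hit_prob x.
Proof. exact: pr_ge0. Qed.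

(* A walk from 1 that converges to a point starting with x passes through x; cut it
   at the first such time. *)
Lemma limit_law_hit x (B : set (boundary d.+1)) : measurable B -> B `&` bstarts (inv_letter x) = set0 ->
  pr limit_law (boundary_act (fg_letter (inv_letter x)) @^-1` B) =
  hit_prob x * pr limit_law B.
Proof.
move=> mB B0; have mX := measurable_limit mB.
have mI n : measurable (iter n T @^-1` (walk_limit @^-1` B)).
  exact: measurable_iterT.
have mE n := measurableI _ _ (measurable_first_hit x n) (mI n).
have mEE : measurable (\bigcup_n (first_hit x n `&` iter n T @^-1` (walk_limit @^-1` B))).
  by apply: bigcup_measurable.
transitivity (pr P (\bigcup_n (first_hit x n `&` iter n T @^-1` (walk_limit @^-1` B)))).
  rewrite -[LHS]/(pr P (walk_limit @^-1`
    (boundary_act (fg_letter (inv_letter x)) @^-1` B))).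
  apply: pr_leaves_eq => //.
    by apply: measurable_limit; exact: measurable_act.
  move=> w lw /=; split.
    (* If the limit did not start with x, its translate by x^-1 would be a point of B starting with
       x^-1. *)
    move=> Bw; have xw : bstarts x (walk_limit w).
      apply: contrapT => h; have : (B `&` bstarts (inv_letter x))
          (boundary_act (fg_letter (inv_letter x)) (walk_limit w)).
        by split => //; apply/bstarts_act; rewrite inv_letterK.
      by rewrite B0.
    have [N _ H] := cvg_to_boundary_starts (walk_limitP lw).
    have := H N (leqnn N); rewrite xw => sN.
    have [m Em] := nearest_neighbour_hit (walk_nearest_neighbour w) sN.
    have [n En] := first_hit_exists Em.
    exists n => //; split => //=; have [E _] := walk_limit_iter n lw.
    by move: Bw; rewrite E En.1 boundary_act_letterK.
  case=> n _ [[En _] /= Bn]; have [E _] := walk_limit_iter n lw.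
  by rewrite E En boundary_act_letterK.
have tI : trivIset setT (fun n => first_hit x n `&` iter n T @^-1` (walk_limit @^-1` B)).
  by move=> i j _ _ [w [[hi _] [hj _]]]; exact: first_hit_inj hi hj.
have t0 : trivIset setT (first_hit x).
  by move=> i j _ _ [w [hi hj]]; exact: first_hit_inj hi hj.
apply: EFin_inj; rewrite EFinM -(prE P mEE) /hit_prob -(prE P (mhit x)).
rewrite !measure_semi_bigcup // muleC -nneseriesZl; last by move=> n _; exact: measure_ge0.
apply: eq_eseriesr => n _.
rewrite [LHS](prE P (mE n)) [X in (_ * X)%E](prE P (measurable_first_hit x n)) -EFinM.
have [Q ->] := first_hitE x n.
by rewrite (pr_letters_upto msigma mT PT n Q mX) mulrC.
Qed.

Lemma limit_law_hitting : hitting_measure (step_law P msigma mT) limit_law.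
Proof.
exists _, O, P, (fun i => step sigma T i), walk_limit; split => //.
- exact: step_independent PT.
- by move=> i A _; exact: distribution_step PT i A.
- exists (~` leaves); split.
  + by apply: measurableC; exact: measurable_leaves.
  + rewrite prE; last by apply: measurableC; exact: measurable_leaves.
    by rewrite leaves_ae.
  + by move=> w /= nc lw; apply: nc; exact: walk_limitP.
Qed.

End RandomWalkLimit.

(** * The hitting measure *)

Section HittingProbability.
Context {R : realType} {d : nat}.
Implicit Types (x y : letter d.+2).

Let odds_le (a b : R) : 0 <= a -> a <= b -> a / (1 + a) <= b / (1 + b).
Proof.
move=> a0 ab.
rewrite ler_pdivrMr ?ltr_wpDr // mulrAC ler_pdivlMr; last by lra.
lra.
Qed.

Let odds_inj (a b : R) : 0 <= a -> 0 <= b -> a / (1 + a) = b / (1 + b) -> a = b.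
Proof.
move=> a0 b0 /eqP; rewrite eqr_div; [|by apply/eqP; lra..].
by move=> /eqP; lra.
Qed.

Let eq_of_sum_odds (a b : letter d.+2 -> R) : (forall x, 0 <= a x) ->
  (forall x, a x <= b x) -> \sum_x a x / (1 + a x) = \sum_x b x / (1 + b x) ->
  forall x, a x = b x.
Proof.
move=> a0 ab /eqP; rewrite eq_sym -subr_eq0 -sumrB psumr_eq0 => [/allP H x|x _]; last first.
  by rewrite subr_ge0 odds_le.
have := H x (mem_index_enum _); rewrite subr_eq0 => /eqP /esym.
by apply: odds_inj => //; exact: le_trans (ab x).
Qed.

Let quad_le (p A B a b : R) : 0 < p -> 0 < A -> A <= B -> 0 <= a -> 0 <= b ->
  a * A = p * (1 - a ^+ 2) -> b * B = p * (1 - b ^+ 2) -> b <= a.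
Proof.
move=> p0 A0 AB a0 b0 Ea Eb; rewrite leNgt; apply/negP => ab.
have h1 : p * (1 - b ^+ 2) <= p * (1 - a ^+ 2).
  by rewrite ler_wpM2l ?(ltW p0) // lerD2l lerN2 ler_sqr ?nnegrE // ltW.
have h2 : b * A <= b * B by rewrite ler_wpM2l.
have h3 : a * A < b * A by rewrite ltr_pM2r.
lra.
Qed.

Variables p F q v : letter d.+2 -> R.
Let U := \sum_x p x * F x.
Hypothesis p_gt0 : forall x, 0 < p x.
Hypothesis p_sum : \sum_x p x = 1.
Hypothesis pV : forall x, p (inv_letter x) = p x.
Hypothesis F01 : forall x, 0 < F x < 1.
Hypothesis U_lt1 : U < 1.
Hypothesis pF : forall x, p x * (1 - F x ^+ 2) = (1 - U) * F x.
Hypothesis F_sum : \sum_x F x / (1 + F x) = 1.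
Hypothesis q_ge0 : forall x, 0 <= q x.
Hypothesis q_le1 : forall x, q x <= 1.
Hypothesis v_ge0 : forall x, 0 <= v x.
Hypothesis v_sum : \sum_x v x = 1.
Hypothesis v_hit : forall x, v x = q x * (1 - v (inv_letter x)).
Hypothesis v_stat : forall x, v x = p x * (1 - v (inv_letter x)) +
  \sum_(y | y != x) p y * (q (inv_letter y) * v x).

Let v_pair x y : x != y -> v x + v y <= 1.
Proof.
move=> xy; rewrite -v_sum (bigD1 x) //= lerD2l (bigD1 y) 1?eq_sym //= lerDl.
exact: sumr_ge0.
Qed.

(** If one cone carried all the mass, a letter y with another index, available in rank at least 2,
    would have v y = v (y^-1) = 0, and stationarity at y would read 0 = p y. *)
Let v_lt1 x : v x < 1.
Proof.
rewrite ltNge; apply/negP => v1.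
have v0 y : y != x -> v y = 0.
  by rewrite eq_sym => /v_pair h; have := v_ge0 y; lra.
pose y : letter d.+2 := (if x.1 == ord0 then ord_max else ord0, false).
have y1 : y.1 != x.1 by rewrite /y /=; have [->//|] := eqVneq x.1 ord0; rewrite eq_sym.
have yx : y != x by apply: contraNneq y1 => ->.
have yx' : inv_letter y != x by apply: contraNneq y1 => <-.
have := v_stat y; rewrite (v0 _ yx) (v0 _ yx') big1.
  by have := p_gt0 y; lra.
by move=> z _; rewrite !mulr0.
Qed.

(** When q are the passage probabilities of the walk, this is its probability of returning to the
    identity. *)
Let U' := \sum_x p x * q (inv_letter x).

(** The first-step equation for passage probabilities, obtained by eliminating v x between [v_hit]
    and [v_stat] and dividing by 1 - v (x^-1), nonzero by [v_lt1]. *)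
Let q_eq x : q x * (1 - U') = p x * (1 - q x * q (inv_letter x)).
Proof.
have E : v x = p x * (1 - v (inv_letter x)) + (U' - p x * q (inv_letter x)) * v x.
  have <- : \sum_(y | y != x) p y * q (inv_letter y) = U' - p x * q (inv_letter x).
    by rewrite /U' [in RHS](bigD1 x) //= addrAC subrr add0r.
  rewrite [LHS]v_stat mulr_suml; congr (_ + _).
  by apply: eq_bigr => y _; rewrite mulrA.
rewrite v_hit in E.
have n0 : 1 - v (inv_letter x) != 0 by rewrite subr_eq0 eq_sym lt_eqF.
by apply: (mulIf n0); lra.
Qed.

(** U' = 1 would force q = 1 in [q_eq], hence v x + v (x^-1) = 1 for every x, and the total mass
    would be the rank, at least 2. *)
Let U'_lt1 : U' < 1.
Proof.
have le1 : U' <= 1.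
  rewrite -p_sum; apply: ler_sum => x _; rewrite ler_piMr //; exact: ltW.
rewrite lt_neqAle le1 andbT; apply/eqP => E.
have q1 x : q x = 1.
  have := q_eq x; rewrite E subrr mulr0 => /esym/eqP.
  rewrite mulf_eq0 gt_eqF //= subr_eq0 => /eqP E1.
  apply/eqP; rewrite eq_le q_le1 /= {1}E1 ler_piMr //.
have : \sum_x v x = \sum_x (1 - v x).
  rewrite -[RHS](reindex_inv_letter (fun x => 1 - v x)).
  by apply: eq_bigr => x _; rewrite v_hit q1 mul1r.
rewrite sumrB v_sum sumr_const cardE -cardE card_prod card_ord card_bool.
have : 4 <= (d.+2 * 2)%:R :> R by rewrite ler_nat; lia.
lra.
Qed.

(* q and F both solve a / (1 - a ^ 2) = p / A, with A = 1 - U' and A = 1 - U, and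
   sum_x a x / (1 + a x) = 1; the solution is monotone in A, so the sum pins A. *)
Lemma hit_prob_unique x : q x = F x /\ v x = F x / (1 + F x).
Proof.
have U1 : 0 < 1 - U' by rewrite subr_gt0.
have U1' : 0 < 1 - U by rewrite subr_gt0.
have qV y : q (inv_letter y) = q y.
  apply: (mulIf (lt0r_neq0 U1)).
  by rewrite !q_eq inv_letterK pV [q (inv_letter y) * _]mulrC.
have qq y : q y * (1 - U') = p y * (1 - q y ^+ 2) by rewrite q_eq qV expr2.
have FF y : F y * (1 - U) = p y * (1 - F y ^+ 2) by rewrite pF mulrC.
have q_neq1 y : 1 - q y ^+ 2 != 0.
  apply/eqP => h; have := qq y; rewrite h mulr0 => /eqP.
  rewrite mulf_eq0 (gt_eqF U1) orbF => /eqP q0.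
  by move: h; rewrite q0 expr0n /=; lra.
have vE y : v y = q y / (1 + q y).
  have n1 : 1 + q y != 0 by apply/eqP; have := q_ge0 y; lra.
  have n2 : 1 - q y != 0.
    by apply: contraNneq (q_neq1 y) => h; rewrite -(expr1n _ 2) subr_sqr h mul0r.
  apply: (mulIf (mulf_neq0 n1 n2)).
  have -> : v y * ((1 + q y) * (1 - q y)) = q y * (1 - q y).
    by have := v_hit y; rewrite (v_hit (inv_letter y)) qV inv_letterK; lra.
  by field.
have sum_q : \sum_x q x / (1 + q x) = 1.
  by rewrite -[RHS]v_sum; apply: eq_bigr => y _; rewrite vE.
have F0 y : 0 <= F y by have /andP[/ltW] := F01 y.
have qF : q x = F x.
  have [le|/ltW le] := leP (1 - U') (1 - U).
    apply/esym; apply: eq_of_sum_odds => // [y|]; last by rewrite sum_q.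
    exact: (quad_le (p_gt0 y) U1 le).
  apply: eq_of_sum_odds => // [y|]; last by rewrite sum_q.
  exact: (quad_le (p_gt0 y) U1' le).
by rewrite vE qF.
Qed.

End HittingProbability.

(* First-passage analysis of the walk with passage probabilities F forces p to be
   proportional to F / (1 - F ^ 2). *)
Lemma step_weights_exist (R : realType) (d : nat) (F : letter d.+1 -> R) :
  (forall x, 0 < F x < 1) -> (forall x, F (inv_letter x) = F x) ->
  \sum_x F x / (1 + F x) = 1 ->
  exists p : letter d.+1 -> R, let U := \sum_x p x * F x in
  [/\ forall x, 0 < p x, \sum_x p x = 1, forall x, p (inv_letter x) = p x, U < 1
    & forall x, p x * (1 - F x ^+ 2) = (1 - U) * F x].
Proof.
move=> F01 FV F_sum.
have D0 x : 0 < 1 - F x ^+ 2.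
  have /andP[h0 h1] := F01 x; rewrite subr_gt0 expr_lt1 // ltW //.
pose S := \sum_x F x / (1 - F x ^+ 2).
have S0 : 0 < S.
  rewrite /S (bigD1 (ord0, false)) //= ltr_wpDr //.
    by apply: sumr_ge0 => x _; rewrite divr_ge0 // ltW //; case/andP: (F01 x).
  by rewrite divr_gt0 //; case/andP: (F01 (ord0, false)).
have nS : S != 0 by rewrite gt_eqF.
exists (fun x => F x / (1 - F x ^+ 2) / S) => U.
(* The term p x (1 - F x) equals F x / (1 + F x) / S, and [F_sum] adds these up to 1 / S. *)
have UE : 1 - U = S^-1.
  have p1 : \sum_x F x / (1 - F x ^+ 2) / S = 1 by rewrite -mulr_suml divff.
  rewrite -[X in X - U]p1 /U -sumrB -[RHS]mul1r -[X in _ = X * _]F_sum mulr_suml; apply: eq_bigr => x _.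
  have n1 : 1 - F x ^+ 2 != 0 by rewrite gt_eqF.
  have n2 : 1 + F x != 0.
    by apply: contraNneq n1 => h; rewrite -(expr1n _ 2) subr_sqr h mulr0.
  by field; rewrite nS n2 n1.
split.
- by move=> x; rewrite !divr_gt0 //; case/andP: (F01 x).
- by rewrite -mulr_suml divff.
- by move=> x; rewrite FV.
- by rewrite -subr_gt0 UE invr_gt0.
- move=> x; rewrite UE; have n1 : 1 - F x ^+ 2 != 0 by rewrite gt_eqF.
  by field; rewrite nS n1.
Qed.

Section GeneratingWeights.
Context {R : realType} {d : nat}.

Lemma push_all (a : pred (letter d)) x w : a x -> all a w -> all a (push x w).
Proof.
by move=> ax; case: w => [|y w] /= => [_|/andP[ay aw]]; [rewrite ax|case: ifP => _ //=; rewrite ax ay].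
Qed.

(** If x had weight 0, so would x^-1 by symmetry, and the support would lie in the proper subgroup
    of words avoiding the generator of index [x.1]. *)
Lemma generating_wt_gt0 (lambda : probability (free_group d) R) :
  symmetric_measure lambda -> supported_on_generators lambda ->
  generating_measure lambda -> forall x, 0 < wt lambda x.
Proof.
move=> lsym lsupp lgen x; rewrite lt_neqAle pr_ge0 andbT eq_sym; apply/eqP => wx.
pose a (y : letter d) := y.1 != x.1.
pose H : {pred free_group d} := fun g => all a (word g).
have aV w : all a (map (@inv_letter d) w) = all a w by rewrite all_map.
have : generator x.1 \in H.
  apply: lgen => [|g].
    split=> [|g h]; rewrite /in_mem //= /H => ag ah.
    rewrite -[X in all a X]/(foldr (@push d) (rev (map (@inv_letter d) (word h))) (word g)).
    elim: (word g) ag => [_|y w IH /= /andP[ay aw]] /=; first by rewrite all_rev aV.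
    by apply: push_all => //; exact: IH.
  move=> lg; have g0 : lambda [set g] != 0%E by rewrite gt_eqF.
  have [y Ey] := supported_letter lsupp g0.
  rewrite /in_mem /= /H Ey /= andbT /a; apply: contraNneq g0 => yx.
  suff : wt lambda y = 0 by rewrite /wt Ey => E; rewrite (prE lambda) // E.
  have [<-//|<-] : x = y \/ inv_letter x = y.
    case: (x) (y) yx => i [] [j []] /= ->; by [left|right].
  by rewrite wt_inv.
by rewrite /in_mem /= /H /= /a eqxx.
Qed.

End GeneratingWeights.

Section BoundaryEntropy.
Context {R : realType} {d : nat}.
Variables (lambda : probability (free_group d.+1) R) (nu : probability (boundary d.+1) R).
Hypothesis lambda_gen : supported_on_generators lambda.
Hypothesis lambda_sym : symmetric_measure lambda.
Variable s : letter d.+1 -> R.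
Hypothesis sV : forall x, s (inv_letter x) = s x.

Lemma boundary_entropy_multiplicative :
  (forall x (B : set (boundary d.+1)), measurable B -> B `&` bstarts (inv_letter x) = set0 ->
    pr nu (boundary_act (fg_letter (inv_letter x)) @^-1` B) = expR (- s x) * pr nu B) ->
  boundary_entropy lambda nu = (\sum_x wt lambda x * (s x * (1 - 2 * pr nu (bstarts x))))%:E.
Proof.
move=> M.
apply: (@entropy_multiplicative _ _ _ _ lambda _ _
  (fun g => (@boundary_act d.+1 g : {mfun boundary d.+1 >-> boundary d.+1}))
  (@bstarts d.+1) s) => //.
- exact: boundary_act_letterK.
- exact: measurable_bstarts.
- by move=> x xi; exact: bstarts_act.
Qed.

End BoundaryEntropy.

Lemma sum_pr_bstarts (R : realType) d (nu : probability (boundary d.+1) R) :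
  \sum_x pr nu (bstarts x) = 1.
Proof.
rewrite -pr_bigsum => [|x|x y xy].
- by rewrite -(prT nu); congr pr; apply/seteqP; split => // xi _; exists (bletter xi 0).
- exact: measurable_bstarts.
- apply/seteqP; split => // xi [xi_x xi_y].
  by move: xy; rewrite (bstarts_inj xi_x xi_y) eqxx.
Qed.

Lemma harmonic_measure_exists (R : realType) (d : nat) (F : letter d.+2 -> R) :
  (forall x, 0 < F x < 1) -> (forall x, F (inv_letter x) = F x) ->
  \sum_x F x / (1 + F x) = 1 ->
  exists (mu : probability (free_group d.+2) R) (nu : probability (boundary d.+2) R),
    [/\ [/\ symmetric_measure mu, supported_on_generators mu & generating_measure mu],
        hitting_measure mu nu,
        forall x, pr nu (bstarts x) = F x / (1 + F x)
      & forall x (B : set (boundary d.+2)), measurable B ->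
          B `&` bstarts (inv_letter x) = set0 ->
          pr nu (boundary_act (fg_letter (inv_letter x)) @^-1` B) = F x * pr nu B].
Proof.
move=> F01 FV F_sum.
have [p [p0 p1 pV U1 pF]] := step_weights_exist F01 FV F_sum.
have [sigma [T [ms mT PT]]] := @bernoulli_shift R (letter d.+2) (ord0, false) p p0 p1.
have pge0 x : 0 <= p x by rewrite ltW.
pose nu := limit_law uniform01 ms mT.
pose q := hit_prob uniform01 sigma T.
have nu_hit x (B : set (boundary d.+2)) : measurable B ->
    B `&` bstarts (inv_letter x) = set0 ->
    pr nu (boundary_act (fg_letter (inv_letter x)) @^-1` B) = q x * pr nu B.
  exact: (limit_law_hit ms mT PT pge0 F01 FV U1 pF).
have mb x : measurable (bstarts x : set (boundary d.+2)) := measurable_bstarts x.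
have disj x y : y != x -> bstarts x `&` bstarts y = set0 :> set (boundary d.+2).
  move=> yx; apply/seteqP; split => // xi [hx hy].
  by move: yx; rewrite (bstarts_inj hx hy) eqxx.
have v_hit x : pr nu (bstarts x) = q x * (1 - pr nu (bstarts (inv_letter x))).
  rewrite -prC // -nu_hit //; last by rewrite setICl.
    congr pr; apply/seteqP; split => xi /=.
      by move=> h /bstarts_act; rewrite inv_letterK.
    by rewrite bstarts_act inv_letterK => /contrapT.
  exact: measurableC.
have v_stat x : pr nu (bstarts x) = p x * (1 - pr nu (bstarts (inv_letter x))) +
    \sum_(y | y != x) p y * (q (inv_letter y) * pr nu (bstarts x)).
  rewrite [LHS](limit_law_stationary ms mT PT pge0 F01 FV U1 pF (mb x)).
  rewrite (bigD1 x) //=; congr (_ * _ + _).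
    rewrite -prC //; congr pr; apply/seteqP; split => xi /=; by rewrite bstarts_act.
  apply: eq_bigr => y yx; congr (_ * _); rewrite -nu_hit ?inv_letterK //.
  exact: disj.
(* Up to here F only served to choose the step weights and to prove transience; now it is identified
   with the true passage probabilities. *)
have [qF vF] : (forall x, q x = F x) /\ (forall x, pr nu (bstarts x) = F x / (1 + F x)).
  have H := @hit_prob_unique R d p F q (fun x => pr nu (bstarts x)) p0 p1 pV F01 U1 pF F_sum
    _ _ _ (sum_pr_bstarts nu) v_hit v_stat.
  by split => x; apply H => y; [exact: hit_prob_ge0|exact: hit_prob_le1|exact: pr_ge0|
    exact: hit_prob_ge0|exact: hit_prob_le1|exact: pr_ge0].
exists (step_law uniform01 ms mT), nu; split.
- split.
  + exact: (step_law_symmetric ms mT PT pV).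
  + exact: (step_law_supported PT).
  + exact: (step_law_generating PT p0).
- exact: (limit_law_hitting ms mT PT pge0 F01 FV U1 pF).
- exact: vF.
- by move=> x B mB B0; rewrite nu_hit // qF.
Qed.

Theorem theoremC (R : realType) (d : nat)
    (lambda : probability (free_group d.+2) R) :
  symmetric_measure lambda ->
  supported_on_generators lambda ->
  generating_measure lambda ->
  exists mu : probability (free_group d.+2) R,
    [/\ symmetric_measure mu,
        supported_on_generators mu,
        generating_measure mu
      & exists nu : probability (boundary d.+2) R,
          hitting_measure mu nu /\
          inf_entropy lambda = boundary_entropy lambda nu].
Proof.
move=> lsym lsupp lgen.
have w0 := generating_wt_gt0 lsym lsupp lgen.
have [|x|c [s [s0 sV s_crit s_sum]]] := @lagrange_multiplier R d (wt lambda).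
- by move=> x; rewrite w0 pr_le1.
- exact: wt_inv.
(* With F = exp(-s), the constraint [s_sum] becomes the condition on F that the boundary cones have
   total mass 1. *)
have odds x : expR (- s x) / (1 + expR (- s x)) = (1 + expR (s x))^-1.
  rewrite expRN; have := expR_gt0 (s x); set a := expR _ => a0.
  have n1 : a != 0 by rewrite gt_eqF.
  have n2 : 1 + a != 0 by rewrite gt_eqF // addr_gt0.
  by field; rewrite n1 ?n2 ?[a + 1]addrC ?n2.
have [|||mu [nu [[mu_sym mu_supp mu_gen] hit nu_cyl nu_mult]]] :=
    @harmonic_measure_exists R d (fun x => expR (- s x)).
- by move=> x; rewrite expR_gt0 expR_lt1 oppr_lt0 s0.
- by move=> x; rewrite sV.
- by rewrite -[RHS]s_sum; apply: eq_bigr => x _; rewrite odds.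
exists mu; split => //; exists nu; split => //.
rewrite (inf_entropyE lsupp lsym s0 sV s_crit s_sum).
rewrite (boundary_entropy_multiplicative lsupp lsym sV nu_mult) /min_entropy.
by congr EFin; apply: eq_bigr => x _; rewrite nu_cyl odds.
Qed.
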